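(* Let $S$ be a $d$-dimensional semimartingale on $(\Omega,\mathcal F,(\mathcal F_t)_{t\in[0,T]},\mathbb P)$ as in the context, and suppose that a separating measure (equivalent to $\mathbb P$) exists for $S$. Then, for every probability measure $\mathbb Q\sim\mathbb P$, every $x>0$, and every $U\in\mathcal{FV}(\mathbb Q)$, the indifference price of every bounded replicable contingent claim $f$ satisfies $$\Pi(f,x,U,\mathbb Q)=x_0,$$ where $x_0$ is the initial value of the replicating strategy for $f$.
   Context: $(\Omega,\mathcal F,\mathbb P)$ is a probability space with a filtration $(\mathcal F_t)_{t\in[0,T]}$, $T\in(0,\infty)$, satisfying the usual conditions, with $\mathcal F_0$ trivial and $\mathcal F=\mathcal F_T$. $S$ models risky asset prices; there is also a riskless asset with price identically $1$. For $x\ge 0$, $$\mathcal X(x)=\{X\ge 0:\ X=x+H\cdot S,\ H\text{ predictable and }S\text{-integrable}\}.$$ Admissible wealth processes are those of the form $X+x_0$ with $x_0\in\mathbb R$ and $X\in\bigcup_{x\ge0}\mathcal X(x)$. A bounded random variable $f$ is replicable if there is an admissible wealth process $X$ such that $-X$ is also admissible and $X_T=f$; the initial value of the replicating strategy is $X_0$. A separating measure for $S$ is a probability measure under which every $X\in\mathcal X(1)$ is a supermartingale. A stochastic utility field is a map $U=U(\omega,x):\Omega\times[0,\infty)\to\mathbb R\cup\{-\infty\}$ such that for every $\omega$, $U(\omega,\cdot)$ is strictly increasing, strictly concave, continuously differentiable on $(0,\infty)$ and satisfies the Inada conditions $\lim_{x\downarrow0}U'(\omega,x)=\infty$, $\lim_{x\to\infty}U'(\omega,x)=0$;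 for every $x\ge0$, $U(\cdot,x)$ is measurable; and $U(\cdot,0)=\lim_{x\downarrow0}U(\cdot,x)$ (possibly $-\infty$). Its conjugate is $V(\omega,y)=\sup_{x>0}(U(\omega,x)-xy)$, $y\ge0$. For a probability measure $\mathbb Q\sim\mathbb P$ and $y\ge0$, $\mathcal Y^{\mathbb Q}(y)$ is the set of processes $Y\ge0$ with $Y_0\le y$ such that $XY$ is a $\mathbb Q$-supermartingale for every $X\in\mathcal X(1)$. $\mathcal{FV}(\mathbb Q)$ is the class of stochastic utility fields $U$ with $$\sup_{X\in\mathcal X(x)}\mathbb E_{\mathbb Q}[U(X_T)]>-\infty\ \ (x>0),\qquad \inf_{Y\in\mathcal Y^{\mathbb Q}(y)}\mathbb E_{\mathbb Q}[V(Y_T)]<\infty\ \ (y>0).$$ Conventions: an expectation of a utility is $-\infty$ if the expectation of its negative part is infinite; $\mathbb E_{\mathbb Q}[V(Y_T)]=\infty$ if $\mathbb E_{\mathbb Q}[V^+(Y_T)]=\infty$. Indifference price. For $f\in\mathbb L^\infty(\Omega,\mathcal F,\mathbb P)$ and $(x,q)\in\mathbb R^2$ let $$\mathcal X(x,q)=\{X=x+H\cdot S:\ X\ge -x'(X)\text{ and }X_T+qf\ge0\},$$ where $H$ is predictable and $S$-integrable and $x'(X)\ge0$ is some constant which may depend on $X$. An indifference price of $f$ corresponding to initial wealth $x>0$, field $U$ and measure $\mathbb Q$ is a constant $\Pi=\Pi(f,x,U,\mathbb Q)$ such that $\mathbb E_{\mathbb Q}[U(X_T+qf)]\le \sup_{X'\in\mathcal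 X(x)}\mathbb E_{\mathbb Q}[U(X'_T)]$ for all $q\in\mathbb R$ and all $X\in\mathcal X(x-q\Pi,q)$. Writing $\Pi(f,x,U,\mathbb Q)=c$ means that the indifference price exists, is unique and equals $c$. *)

(* Defs.v *)
From HB Require Import structures.
From mathcomp Require Import all_boot all_order all_algebra.
From mathcomp Require Import all_classical all_reals all_analysis.
From mathcomp Require Import measurable_realfun.
Set Implicit Arguments.
Unset Strict Implicit.
Unset Printing Implicit Defensive.
Import Order.TTheory GRing.Theory Num.Theory.
Import numFieldNormedType.Exports.
Local Open Scope classical_set_scope.
Local Open Scope ring_scope.

(* The time set is [0, T]. Processes are total functions of a real time, whose *)
(* values outside [0, T] are never used. The filtration is a family            *)
(* F : R -> set (set Omega), likewise only used on [0, T].                     *)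

Section Filtrations.
Context {disp : measure_display} {Omega : measurableType disp} {R : realType}.

Definition process := R -> Omega -> R.

Definition equivalent_measures (Q P : probability Omega R) : Prop :=
  Q `<< P /\ P `<< Q.

Variables (P : probability Omega R) (T : R) (F : R -> set (set Omega)).

Record usual_filtration : Prop := UsualFiltration {
  filtration_sigma : forall t, 0 <= t <= T -> sigma_algebra setT (F t) ;
  filtration_mono : forall s t, 0 <= s -> s <= t -> t <= T -> F s `<=` F t ;
  filtration_right_continuous : forall t, 0 <= t < T ->
    F t = \bigcap_(s in [set s | t < s <= T]) F s ;
  filtration_complete : forall N, P.-negligible N -> F 0 N ;
  filtration_trivial : forall A, F 0 A -> P A = 0%E \/ P A = 1%E ;
  filtration_final : F T = measurable }.

Definition rv_measurable (G : set (set Omega)) (h : Omega -> R) : Prop :=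
  forall B : set R, measurable B -> G (h @^-1` B).

Definition adapted (X : process) : Prop :=
  forall t, 0 <= t <= T -> rv_measurable (F t) (X t).

Definition cadlag (X : process) : Prop := forall w,
  (forall t, 0 <= t < T -> X s w @[s --> t^'+] --> X t w) /\
  (forall t, 0 < t <= T -> exists l : R, X s w @[s --> t^'-] --> l).

(* The conditional inequality E_Q[X_t | F_s] <= X_s is tested on the sets of F_s. *)
Definition supermartingale (Q : probability Omega R) (X : process) : Prop :=
  [/\ adapted X,
      (forall t, 0 <= t <= T -> Q.-integrable setT (EFin \o X t)) &
      forall s t A, 0 <= s -> s <= t -> t <= T -> F s A ->
        (\int[Q]_(w in A) (X t w)%:E <= \int[Q]_(w in A) (X s w)%:E)%E].

Definition martingale (Q : probability Omega R) (X : process) : Prop :=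
  supermartingale Q X /\ supermartingale Q (fun t w => - X t w).

Definition stopping_time (tau : Omega -> R) : Prop :=
  (forall w, 0 <= tau w <= T) /\
  (forall t, 0 <= t <= T -> F t [set w | tau w <= t]).

Definition local_martingale (M : process) : Prop :=
  [/\ adapted M, cadlag M &
    exists tau : nat -> Omega -> R,
      [/\ forall n, stopping_time (tau n),
          forall n w, tau n w <= tau n.+1 w,
          {ae P, forall w, exists n, tau n w = T} &
          forall n, martingale P
            (fun t w => M (Num.min t (tau n w)) w - M 0 w)]].

Definition finite_variation (A : process) : Prop :=
  [/\ adapted A, cadlag A & forall w, bounded_variation 0 T (A ^~ w)].

Definition semimartingale (X : process) : Prop :=
  exists M A : process, [/\ local_martingale M, finite_variation A &
    forall t w, 0 <= t <= T -> X t w = M t w + A t w].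

End Filtrations.

Section StochasticIntegral.
Context {disp : measure_display} {Omega : measurableType disp} {R : realType}.
Variables (P : probability Omega R) (T : R) (F : R -> set (set Omega)).
Local Notation process := (@process disp Omega R).

Definition predictable_sets : set (set (R * Omega)) :=
  <<s [set p | 0 <= p.1 <= T],
    [set E | exists2 A, F 0 A & E = [set 0] `*` A] `|`
    [set E | exists s t A, [/\ 0 <= s, s <= t, t <= T, F s A &
                               E = `]s, t]%classic `*` A]] >>.

Definition predictable (H : process) : Prop := forall B : set R, measurable B ->
  predictable_sets [set p | 0 <= p.1 <= T /\ B (H p.1 p.2)].

Definition bounded_rv (G : set (set Omega)) (h : Omega -> R) : Prop :=
  rv_measurable G h /\ exists c, forall w, `|h w| <= c.

(* Elementary integrands  h_0 1_{0} + sum_k h_k 1_(s_k, t_k]  with h_0 bounded *)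
(* F_0-measurable and h_k bounded F_(s_k)-measurable. The component at time 0  *)
(* is needed to generate all predictable sets; integrals (H . S)_t are over    *)
(* (0, t], so that (H . S)_0 = 0.                                              *)
Record elementary := Elementary {
  el_init : Omega -> R ;
  el_size : nat ;
  el_left : nat -> R ;
  el_right : nat -> R ;
  el_coef : nat -> Omega -> R ;
  el_initP : bounded_rv (F 0) el_init ;
  el_timeP : forall k, (k < el_size)%N ->
    [/\ 0 <= el_left k, el_left k <= el_right k & el_right k <= T] ;
  el_coefP : forall k, (k < el_size)%N -> bounded_rv (F (el_left k)) (el_coef k) }.

Definition el_process (K : elementary) : process := fun t w =>
  el_init K w * (t == 0)%R%:R +
  \sum_(k < el_size K) el_coef K k w * (el_left K k < t <= el_right K k)%R%:R.

Definition el_integral (K : elementary) (M : process) : process := fun t w =>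
  \sum_(k < el_size K) el_coef K k w *
    (M (Num.min (el_right K k) t) w - M (Num.min (el_left K k) t) w).

(* The suprema over [0, T] below are measurable for cadlag processes; the      *)
(* outer probability makes the definition meaningful without using this fact.  *)
Definition outer_prob_le (B : set Omega) (delta : R) : Prop :=
  exists A, [/\ measurable A, (P A <= delta%:E)%E & B `<=` A].

Definition ucp_cvg (Xn : nat -> process) (X : process) : Prop :=
  forall eps delta : R, 0 < eps -> 0 < delta -> \forall n \near \oo,
    outer_prob_le
      [set w | exists2 t, 0 <= t <= T & eps < `|Xn n t w - X t w|] delta.

(* Convergence in the Emery (semimartingale) topology: the integrals           *)
(* K_0 (Xn - X)_0 + K . (Xn - X) converge to 0 in ucp, uniformly over the      *)
(* elementary integrands K bounded by 1.                                       *)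
Definition emery_cvg (Xn : nat -> process) (X : process) : Prop :=
  forall eps delta : R, 0 < eps -> 0 < delta -> \forall n \near \oo,
    forall K : elementary,
      (forall t w, 0 <= t <= T -> `|el_process K t w| <= 1) ->
      outer_prob_le
        [set w | exists2 t, 0 <= t <= T &
           eps < `| el_init K w * (Xn n 0 w - X 0 w) +
                    el_integral K (fun s v => Xn n s v - X s v) t w |] delta.

(* bounded_integral M H X : X is (a version of) the integral H . M of the      *)
(* bounded predictable H with respect to the semimartingale M. The graph of    *)
(* the integral is the closure of the elementary integrals under dominated     *)
(* convergence: bounded pointwise limits of integrands, ucp limits of          *)
(* integrals. By the monotone class theorem every bounded predictable H is     *)
(* reached, and by the dominated convergence theorem for stochastic integrals  *)
(* X is unique up to indistinguishability.                                     *)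
Inductive bounded_integral (M : process) : process -> process -> Prop :=
| bounded_integral_elementary (K : elementary) :
    bounded_integral M (el_process K) (el_integral K M)
| bounded_integral_limit (Hn Xn : nat -> process) (H X : process) (c : R) :
    (forall n, bounded_integral M (Hn n) (Xn n)) ->
    (forall n t w, 0 <= t <= T -> `|Hn n t w| <= c) ->
    (forall t w, 0 <= t <= T -> Hn n t w @[n --> \oo] --> H t w) ->
    adapted T F X -> cadlag T X -> ucp_cvg Xn X ->
    bounded_integral M H X.

Definition bounded_vector_integral (d : nat) (S H : 'I_d -> process)
    (X : process) : Prop :=
  exists2 Y : 'I_d -> process,
    (forall i, bounded_integral (S i) (H i) (Y i)) &
    forall t w, 0 <= t <= T -> X t w = \sum_(i < d) Y i t w.

(* stochastic_integral S H X : the predictable H is S-integrable and X = H . S *)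
(* (vector stochastic integral). H is S-integrable if it is the pointwise      *)
(* limit of bounded predictable Hn such that the Hn . S converge in the Emery  *)
(* topology, and the limit is then H . S; it does not depend on the sequence,  *)
(* and one may take Hn = H 1_{|H| <= n}. Only the sum over the components has  *)
(* to converge: the component integrals need not exist separately.             *)
Definition stochastic_integral (d : nat) (S H : 'I_d -> process)
    (X : process) : Prop :=
  [/\ forall i, predictable (H i), adapted T F X, cadlag T X &
    exists (Hn : nat -> 'I_d -> process) (Xn : nat -> process),
      [/\ forall n, bounded_vector_integral S (Hn n) (Xn n),
          forall i t w, 0 <= t <= T -> Hn n i t w @[n --> \oo] --> H i t w &
          emery_cvg Xn X]].

End StochasticIntegral.

Section UtilityFields.
Context {disp : measure_display} {Omega : measurableType disp} {R : realType}.
Local Open Scope ereal_scope.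

(* Only the values U w x for 0 <= x are constrained or used. Strict            *)
(* monotonicity and U < +oo make U w x finite for 0 < x, where `fine` is then  *)
(* the identity.                                                               *)
Record utility_field (U : Omega -> R -> \bar R) : Prop := UtilityField {
  uf_lty : forall w (x : R), (0 <= x)%R -> U w x < +oo ;
  uf_increasing : forall w (x y : R), (0 <= x)%R -> (x < y)%R -> U w x < U w y ;
  uf_concave : forall w (x y t : R), (0 <= x)%R -> (0 <= y)%R -> x != y ->
    (0 < t < 1)%R ->
    t%:E * U w x + (1 - t)%:E * U w y < U w (t * x + (1 - t) * y)%R ;
  uf_C1 : forall w (x : R), (0 < x)%R ->
    derivable (fun z => fine (U w z)) x 1 /\
    {for x, continuous (derive1 (fun z => fine (U w z)))} ;
  uf_inada0 : forall w, (derive1 (fun z => fine (U w z))) x @[x --> 0%R^'+] --> +oo%R ;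
  uf_inadaoo : forall w,
    (derive1 (fun z => fine (U w z))) x @[x --> +oo%R] --> (0 : R)%R ;
  uf_measurable : forall x : R, (0 <= x)%R -> measurable_fun setT (U ^~ x) ;
  uf_zero : forall w, U w x @[x --> 0%R^'+] --> U w 0%R }.

Definition conjugate (U : Omega -> R -> \bar R) (w : Omega) (y : R) : \bar R :=
  ereal_sup [set U w x - (x * y)%:E | x in [set x | (0 < x)%R]].

Definition utility_expectation (Q : probability Omega R)
    (g : Omega -> \bar R) : \bar R :=
  if \int[Q]_w (g^\- w) == +oo then -oo else \int[Q]_w g w.

Definition conjugate_expectation (Q : probability Omega R)
    (g : Omega -> \bar R) : \bar R :=
  if \int[Q]_w (g^\+ w) == +oo then +oo else \int[Q]_w g w.

End UtilityFields.

Section Market.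
Context {disp : measure_display} {Omega : measurableType disp} {R : realType}.
Variables (P : probability Omega R) (T : R) (F : R -> set (set Omega)).
Local Notation process := (@process disp Omega R).
Variables (d : nat) (S : 'I_d -> process).

(* X = x + H . S for some predictable S-integrable H *)
Definition wealth (x : R) (X : process) : Prop :=
  exists H : 'I_d -> process,
    stochastic_integral P T F S H (fun t w => X t w - x).

Definition nonneg_wealth (x : R) (X : process) : Prop :=
  wealth x X /\ {ae P, forall w, forall t, 0 <= t <= T -> 0 <= X t w}.

Definition admissible (X : process) : Prop :=
  exists (x x0 : R) (X' : process), [/\ 0 <= x, nonneg_wealth x X' &
    forall t w, 0 <= t <= T -> X t w = X' t w + x0].

Definition bounded_claim (f : Omega -> R) : Prop :=
  measurable_fun setT f /\ exists c : R, {ae P, forall w, `|f w| <= c}.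

Definition replicates (X : process) (f : Omega -> R) : Prop :=
  [/\ admissible X, admissible (fun t w => - X t w) &
      {ae P, forall w, X T w = f w}].

Definition separating_measure (Q : probability Omega R) : Prop :=
  forall X, nonneg_wealth 1 X -> supermartingale T F Q X.

Definition deflators (Q : probability Omega R) (y : R) (Y : process) : Prop :=
  [/\ {ae P, forall w, forall t, 0 <= t <= T -> 0 <= Y t w},
      {ae P, forall w, Y 0 w <= y} &
      forall X, nonneg_wealth 1 X ->
        supermartingale T F Q (fun t w => X t w * Y t w)].

Definition maximal_utility (Q : probability Omega R) (U : Omega -> R -> \bar R)
    (x : R) : \bar R :=
  ereal_sup [set utility_expectation Q (fun w => U w (X T w)) |
             X in nonneg_wealth x].

Definition minimal_conjugate (Q : probability Omega R)
    (U : Omega -> R -> \bar R) (y : R) : \bar R :=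
  ereal_inf [set conjugate_expectation Q (fun w => conjugate U w (Y T w)) |
             Y in deflators Q y].

(* the class FV(Q) *)
Definition finite_value_field (Q : probability Omega R)
    (U : Omega -> R -> \bar R) : Prop :=
  [/\ utility_field U,
      forall x, 0 < x -> (-oo < maximal_utility Q U x)%E &
      forall y, 0 < y -> (minimal_conjugate Q U y < +oo)%E].

(* the set X(x, q) of wealth processes for the claim q f *)
Definition claim_wealth (f : Omega -> R) (x q : R) (X : process) : Prop :=
  [/\ wealth x X,
      exists2 x' : R, 0 <= x' &
        {ae P, forall w, forall t, 0 <= t <= T -> - x' <= X t w} &
      {ae P, forall w, 0 <= X T w + q * f w}].

Definition indifference_price (f : Omega -> R) (x : R)
    (U : Omega -> R -> \bar R) (Q : probability Omega R) (price : R) : Prop :=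
  forall (q : R) (X : process), claim_wealth f (x - q * price) q X ->
    (utility_expectation Q (fun w => U w (X T w + q * f w)%R) <=
     maximal_utility Q U x)%E.

End Market.

(* Main.v *)
(* The replicating wealth Z is bounded, starts at x0 and ends at f. If X lies    *)
(* in X(x - q x0, q), then W = X + q Z is a wealth process from x, bounded below *)
(* with W_T >= 0; it is a supermartingale under the separating measure, so       *)
(* W >= 0, W is in X(x), and W_T = X_T + q f. Hence x0 is a price.               *)
(* Conversely, a price p <> x0 lets one trade f for any amount e > 0 of cash:    *)
(* E[U(X_T + e)] <= u(x) for all X in X(x). This is impossible: u(x) is finite   *)
(* by Fenchel's inequality, and E[U(X_T + e)] - E[U(X_T)] is bounded below by a  *)
(* positive constant uniformly in X, since by concavity the increment of U over  *)
(* [X_T, X_T + e] is at least that over [k, k + e] on {X_T <= k}, an event whose *)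
(* probability is bounded below by Markov's inequality under the separating      *)
(* measure.                                                                      *)
Require Import Defs.
From mathcomp Require Import all_boot all_order all_algebra.
From mathcomp Require Import all_classical all_reals all_analysis.
From mathcomp Require Import measurable_realfun.
From mathcomp Require Import ring lra.
Import Order.TTheory GRing.Theory Num.Theory.
Import numFieldNormedType.Exports.
Local Open Scope classical_set_scope.
Local Open Scope ring_scope.

Set Implicit Arguments.
Unset Strict Implicit.
Unset Printing Implicit Defensive.

(** A claim f replicated by the bounded wealth process Z is interchangeable with Z
    ([replicating_wealth]). Adding q Z to a strategy X in X(x - q x0, q) gives a wealth process from
    x, bounded below, with terminal value X_T + q f >= 0. Up to an affine change it is a
    supermartingale under the separating measure Q0, hence nonnegative at all times
    ([wealth_terminal_ge0]), so it competes in the supremum u(x), that is [maximal_utility]. Thus x0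
    is a price ([indifference_price_replicable]).

    If some p other than x0 were a price, every X in X(x) could receive one unit of cash without its
    expected utility exceeding u(x) ([indifference_price_cash]); [maximal_utility_cash] refutes
    this. As u(x) is not known to be attained, the gain from the cash must be bounded below
    uniformly in X. By concavity it is on {X_T <= 4x}, an event of Q0-probability at least 3/4
    ([utility_gap], [separating_markov]), and a near-optimal X then exceeds u(x). Finiteness of
    u(x), needed to choose this X, follows from Fenchel's inequality with a single deflator
    ([utility_bound], [deflator_bound]).

    All this combines wealth processes linearly. The integral being defined by successive limits,
    its linearity is proved for elementary, then bounded, then general integrands ([elementary_lin],
    [bounded_integral_lin], [stochastic_integral_lin]). *)

(** * Measurability with respect to a sigma-algebra given as a family of sets *)

Section SigmaAlgebras.
Context {V : pointedType} {R : realType}.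
Variables (G : set (set V)) (sG : sigma_algebra setT G).

(** A sigma-algebra is the one it generates, so conditions on preimages inherit the arithmetic
    closure properties of measurable functions. *)
Lemma sigma_algebra_measurable_funP (h : V -> R) :
  (forall B : set R, measurable B -> G (h @^-1` B)) <->
  measurable_fun setT (h : g_sigma_algebraType G -> R).
Proof.
rewrite /measurable_fun measurable_g_measurableTypeE//; split.
  by move=> mh _ B mB; rewrite setTI; exact: mh.
move=> mh B mB; rewrite -[X in G X]setTI; apply: mh => //.
by case: sG => G0 GC _; rewrite -(setD0 setT); exact: GC.
Qed.

Lemma sigma_algebra_preimage_lin (h k : V -> R) (a : R) :
  (forall B : set R, measurable B -> G (h @^-1` B)) ->
  (forall B : set R, measurable B -> G (k @^-1` B)) ->
  forall B : set R, measurable B -> G ((fun v => h v + a * k v) @^-1` B).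
Proof.
move=> /sigma_algebra_measurable_funP mh /sigma_algebra_measurable_funP mk.
apply/sigma_algebra_measurable_funP.
by apply: measurable_funD => //; exact: measurable_funM.
Qed.

Lemma sigma_algebra_preimageM (h k : V -> R) :
  (forall B : set R, measurable B -> G (h @^-1` B)) ->
  (forall B : set R, measurable B -> G (k @^-1` B)) ->
  forall B : set R, measurable B -> G ((fun v => h v * k v) @^-1` B).
Proof.
move=> /sigma_algebra_measurable_funP mh /sigma_algebra_measurable_funP mk.
by apply/sigma_algebra_measurable_funP; exact: measurable_funM.
Qed.

Lemma sigma_algebra_preimage_cst (a : R) (B : set R) :
  measurable B -> G ((fun=> a) @^-1` B).
Proof.
by move: B; apply/sigma_algebra_measurable_funP; exact: measurable_cst.
Qed.

End SigmaAlgebras.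

Section Predictable.
Context {disp : measure_display} {Omega : measurableType disp} {R : realType}.
Variables (T : R) (F : R -> set (set Omega)).

(** [predictable_sets] is a sigma-algebra on the strip of times in [0, T]; pulled back to the whole
    product, it falls under the lemmas on sigma-algebras over [setT]. *)
Let trace : set (set (R * Omega)) :=
  [set E | predictable_sets T F ([set p | 0 <= p.1 <= T] `&` E)].

Let sigma_algebra_trace : sigma_algebra setT trace.
Proof.
rewrite /trace; split => [|A pA|A pA] /=.
- by rewrite setI0; exact: sigma_algebra0.
- rewrite setTD.
  rewrite (_ : _ `&` _ = [set p | 0 <= p.1 <= T] `\`
    ([set p | 0 <= p.1 <= T] `&` A)); last first.
    by rewrite setDIr setDv set0U setDE.
  exact: sigma_algebraCD.
- by rewrite setI_bigcupr; exact: sigma_algebra_bigcup.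
Qed.

Lemma predictable_lin (H K : R -> Omega -> R) (a : R) :
  predictable T F H -> predictable T F K ->
  predictable T F (fun t w => H t w + a * K t w).
Proof.
move=> pH pK.
exact: (@sigma_algebra_preimage_lin _ _ _ sigma_algebra_trace
  (fun p => H p.1 p.2) (fun p => K p.1 p.2) a pH pK).
Qed.

End Predictable.

(** * Closure properties of cadlag and adapted processes *)

Section Cadlag.
Context {disp : measure_display} {Omega : measurableType disp} {R : realType}.
Variables (T : R) (F : R -> set (set Omega)).
Implicit Types X Y : R -> Omega -> R.

Lemma cadlag_lin X Y (a : R) :
  cadlag T X -> cadlag T Y -> cadlag T (fun t w => X t w + a * Y t w).
Proof.
move=> cX cY w; have [Xr Xl] := cX w; have [Yr Yl] := cY w; split=> t ht.
- by apply: cvgD; [exact: Xr|apply: cvgM; [exact: cvg_cst|exact: Yr]].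
- have [l1 Xl1] := Xl _ ht; have [l2 Yl2] := Yl _ ht; exists (l1 + a * l2).
  by apply: cvgD; [exact: Xl1|apply: cvgM; [exact: cvg_cst|exact: Yl2]].
Qed.

Lemma cadlag_cst (c : Omega -> R) : cadlag T (fun=> c).
Proof. by move=> w; split=> t _; [|exists (c w)]; apply: cvg_cst. Qed.

Lemma cadlag_mulr (c : Omega -> R) X :
  cadlag T X -> cadlag T (fun t w => c w * X t w).
Proof.
move=> cX w; have [Xr Xl] := cX w; split=> t ht.
- by apply: cvgM; [exact: cvg_cst|exact: Xr].
- have [l Xl1] := Xl _ ht; exists (c w * l).
  by apply: cvgM; [exact: cvg_cst|exact: Xl1].
Qed.

(** The one-sided limits in question only involve times close enough to t to lie in [0, T]. *)
Lemma eq_cadlag X Y : (forall t w, 0 <= t <= T -> X t w = Y t w) ->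
  cadlag T X -> cadlag T Y.
Proof.
move=> XY cX w; have [Xr Xl] := cX w; split=> t /andP[t0 tT].
- rewrite -XY ?t0 ?(ltW tT)//; have := Xr t; rewrite t0 tT => /(_ isT).
  apply: cvg_trans; apply: near_eq_cvg; near=> s.
  rewrite XY//; apply/andP; split.
    by apply: (le_trans t0); near: s; exact: nbhs_right_ge.
  by near: s; exact: nbhs_right_le.
- have := Xl t; rewrite t0 tT => -[//|l Xtl]; exists l.
  move: Xtl; apply: cvg_trans; apply: near_eq_cvg; near=> s.
  rewrite XY//; apply/andP; split.
    by near: s; exact: nbhs_left_ge.
  by apply: le_trans tT; near: s; exact: nbhs_left_le.
Unshelve. all: by end_near. Qed.

Lemma cadlag_stop X (r : R) : 0 <= r <= T ->
  cadlag T X -> cadlag T (fun t => X (Num.min r t)).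
Proof.
move=> /andP[r0 rT] cX w; have [Xr Xl] := cX w; split=> t /andP[t0 tT].
- have [tr|rt] := ltP t r.
  + have := Xr t; rewrite t0 tT => /(_ isT).
    apply: cvg_trans; apply: near_eq_cvg; near=> s.
    by rewrite min_r//; near: s; exact: nbhs_right_le.
  + have : (fun=> X r w) s @[s --> t^'+] --> X r w by exact: cvg_cst.
    apply: cvg_trans; apply: near_eq_cvg; near=> s.
    by rewrite min_l//; apply: (le_trans rt); near: s; exact: nbhs_right_ge.
- have [rt|tr] := ltP r t.
  + exists (X r w).
    have : (fun=> X r w) s @[s --> t^'-] --> X r w by exact: cvg_cst.
    apply: cvg_trans; apply: near_eq_cvg; near=> s.
    by rewrite min_l//; near: s; exact: nbhs_left_ge.
  + have := Xl t; rewrite t0 tT => -[//|l Xtl]; exists l.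
    move: Xtl; apply: cvg_trans; apply: near_eq_cvg; near=> s.
    by rewrite min_r//; apply: le_trans tr; near: s; exact: nbhs_left_le.
Unshelve. all: by end_near. Qed.

Hypothesis sF : forall t, 0 <= t <= T -> sigma_algebra setT (F t).

Lemma adapted_lin X Y (a : R) :
  adapted T F X -> adapted T F Y -> adapted T F (fun t w => X t w + a * Y t w).
Proof.
move=> aX aY t ht.
by apply: sigma_algebra_preimage_lin; [exact: sF|exact: aX|exact: aY].
Qed.

Lemma adapted_cst (c : R) : adapted T F (fun _ _ => c).
Proof. by move=> t ht B mB; apply: sigma_algebra_preimage_cst => //; exact: sF. Qed.

Lemma eq_adapted X Y : (forall t w, 0 <= t <= T -> X t w = Y t w) ->
  adapted T F X -> adapted T F Y.
Proof.
move=> XY aX t ht B mB.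
by rewrite (_ : Y t = X t); [exact: aX|apply/funext => w; rewrite XY].
Qed.

End Cadlag.

Lemma process_sum_ind {disp : measure_display} {Omega : measurableType disp}
    {R : realType} (Pr : (R -> Omega -> R) -> Prop) (I : Type) (s : seq I)
    (f : I -> R -> Omega -> R) :
  Pr (fun _ _ => 0) ->
  (forall X Y, Pr X -> Pr Y -> Pr (fun t w => X t w + Y t w)) ->
  (forall i, Pr (f i)) -> Pr (fun t w => \sum_(i <- s) f i t w).
Proof.
move=> P0 PD Pf; elim: s => [|i s IH].
  rewrite (_ : (fun _ _ => _) = fun _ _ => 0)//.
  by apply/funext => t; apply/funext => w; rewrite big_nil.
rewrite (_ : (fun _ _ => _) = fun t w => f i t w + \sum_(j <- s) f j t w).
  exact: PD.
by apply/funext => t; apply/funext => w; rewrite big_cons.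
Qed.

(** * Linearity of the integral of bounded integrands *)

Section BoundedIntegrals.
Context {disp : measure_display} {Omega : measurableType disp} {R : realType}.
Variables (P : probability Omega R) (T : R) (F : R -> set (set Omega)).
Hypotheses (T_gt0 : 0 < T)
  (sF : forall t, 0 <= t <= T -> sigma_algebra setT (F t))
  (monoF : forall s t, 0 <= s -> s <= t -> t <= T -> F s `<=` F t).
Local Notation process := (R -> Omega -> R).
Implicit Types (M H X : process) (K L : elementary T F).

Lemma bounded_rv_lin t (h k : Omega -> R) (a : R) : 0 <= t <= T ->
  bounded_rv (F t) h -> bounded_rv (F t) k ->
  bounded_rv (F t) (fun w => h w + a * k w).
Proof.
move=> ht [mh [c hc]] [mk [e ke]]; split.
  exact: (sigma_algebra_preimage_lin (sF ht)).
exists (c + `|a| * e) => w.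
rewrite (le_trans (ler_normD _ _))// lerD// normrM.
by rewrite ler_wpM2l.
Qed.

Lemma bounded_rv0 t : 0 <= t <= T -> bounded_rv (F t) (fun=> 0 : R).
Proof.
move=> ht; split; last by exists 0 => w; rewrite normr0.
by move=> B mB; exact: sigma_algebra_preimage_cst (sF ht) 0 B mB.
Qed.

(** The two lists of intervals are concatenated: [sel] reads the data of K below n = [el_size K] and
    those of L, shifted by n, from there on. *)
Lemma elementary_lin K L (a : R) : exists N : elementary T F,
  el_process N = (fun t w => el_process K t w + a * el_process L t w) /\
  forall M, el_integral N M =
    (fun t w => el_integral K M t w + a * el_integral L M t w).
Proof.
have T0 : 0 <= (0 : R) <= T by rewrite lexx ltW.
pose n := el_size K.
pose sel (A : Type) (f g : nat -> A) k := if (k < n)%N then f k else g (k - n)%N.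
have selP (k : nat) : (k < n + el_size L)%N -> (k < n)%N || (k - n < el_size L)%N.
  by have [//|nk] := ltnP k n; rewrite ltn_subLR.
have timeP k : (k < n + el_size L)%N -> [/\ 0 <= sel _ (el_left K) (el_left L) k,
    sel _ (el_left K) (el_left L) k <= sel _ (el_right K) (el_right L) k &
    sel _ (el_right K) (el_right L) k <= T].
  rewrite /sel => /selP; case: ltnP => [kn _|_ /= kn]; exact: el_timeP.
have coefP k : (k < n + el_size L)%N ->
    bounded_rv (F (sel _ (el_left K) (el_left L) k))
      (sel _ (el_coef K) (fun j w => a * el_coef L j w) k).
  move=> kn; move: (timeP _ kn) (selP _ kn).
  rewrite /sel; case: ltnP => [kn' _ _|_ /= [l0 lr rT] kn'].
    exact: el_coefP.
  have ht : 0 <= el_left L (k - n) <= T by rewrite l0 (le_trans lr).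
  rewrite (_ : (fun w => _) = (fun w => 0 + a * el_coef L (k - n) w)).
    by apply: bounded_rv_lin => //; [exact: bounded_rv0|exact: el_coefP].
  by apply/funext => w; rewrite add0r.
exists (Elementary (bounded_rv_lin a T0 (el_initP K) (el_initP L)) timeP coefP).
have selr (A : Type) (f g : nat -> A) (k : 'I_(el_size L)) :
    sel _ f g (n + k)%N = g k.
  by rewrite /sel ltnNge leq_addr/= addKn.
have sell (A : Type) (f g : nat -> A) (k : 'I_n) : sel _ f g k = f k.
  by rewrite /sel ltn_ord.
split=> [|M]; apply/funext => t; apply/funext => w.
- rewrite /el_process/= big_split_ord/= mulrDl mulrDr mulr_sumr mulrA addrACA.
  congr (_ + _ + (_ + _)); apply: eq_bigr => k _; rewrite ?selr ?sell//.
  by rewrite mulrA.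
- rewrite /el_integral/= big_split_ord/= mulr_sumr.
  congr (_ + _); apply: eq_bigr => k _; rewrite ?selr ?sell//.
  by rewrite mulrA.
Qed.

Lemma el_integral_lin K M X (a : R) t w :
  el_integral K (fun s v => M s v + a * X s v) t w =
  el_integral K M t w + a * el_integral K X t w.
Proof.
rewrite /el_integral mulr_sumr -big_split/=; apply: eq_bigr => k _; ring.
Qed.

Lemma adapted_el_integral K M : adapted T F M -> adapted T F (el_integral K M).
Proof.
move=> aM; apply: (process_sum_ind (index_enum _)
    (f := fun k : 'I_(el_size K) => fun t w => el_coef K k w *
    (M (Num.min (el_right K k) t) w - M (Num.min (el_left K k) t) w))).
- exact: adapted_cst.
- move=> X Y aX aY; have := adapted_lin sF 1 aX aY.
  by under eq_fun do under eq_fun do rewrite mul1r.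
move=> k t ht; have /andP[t0 tT] := ht.
have [l0 lr rT] := el_timeP (ltn_ord k).
(* Before its left endpoint the k-th term vanishes; from then on its coefficient is measurable for
   [F t] by monotonicity. *)
have [tl|] := boolP (t < el_left K k); last rewrite -leNgt => lt.
  rewrite (_ : (fun w => _) = fun=> 0).
    by move=> B; exact: sigma_algebra_preimage_cst (sF ht) 0 B.
  apply/funext => w.
  by rewrite (min_r (ltW tl)) (min_r (le_trans (ltW tl) lr)) subrr mulr0.
have mM r : 0 <= r <= T -> rv_measurable (F t) (M (Num.min r t)).
  move=> /andP[r0 rT'] B mB; apply: (@monoF (Num.min r t) t) => //.
  - by rewrite le_min r0 t0.
  - by rewrite ge_min lexx orbT.
  - by apply: aM => //; rewrite le_min r0 t0 ge_min rT'.
apply: (sigma_algebra_preimageM (sF ht)).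
  move=> B mB; apply: (monoF l0 lt tT).
  by have [mc _] := el_coefP (ltn_ord k); exact: mc.
rewrite (_ : (fun w => _) = fun w => M (Num.min (el_right K k) t) w +
    (-1) * M (Num.min (el_left K k) t) w); last first.
  by apply/funext => w; rewrite mulN1r.
apply: (sigma_algebra_preimage_lin (sF ht)); apply: mM.
  by rewrite (le_trans l0 lr).
by rewrite l0 (le_trans lr).
Qed.

Lemma cadlag_el_integral K M : cadlag T M -> cadlag T (el_integral K M).
Proof.
move=> cM; apply: (process_sum_ind (index_enum _)
    (f := fun k : 'I_(el_size K) => fun t w => el_coef K k w *
    (M (Num.min (el_right K k) t) w - M (Num.min (el_left K k) t) w))).
- exact: cadlag_cst.
- move=> X Y aX aY; have := cadlag_lin 1 aX aY.
  by under eq_fun do under eq_fun do rewrite mul1r.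
move=> k; apply: (cadlag_mulr (el_coef K k)).
have [l0 lr rT] := el_timeP (ltn_ord k).
have hl : 0 <= el_left K k <= T by rewrite l0 (le_trans lr).
have hr : 0 <= el_right K k <= T by rewrite rT (le_trans l0).
have := cadlag_lin (-1) (cadlag_stop hr cM) (cadlag_stop hl cM).
by under eq_fun do under eq_fun do rewrite mulN1r.
Qed.

Lemma bounded_el_process K :
  exists c, forall t w, 0 <= t <= T -> `|el_process K t w| <= c.
Proof.
pose Pr X := exists c, forall t w, 0 <= t <= T -> `|X t w| <= c :> R.
have PrD X Y : Pr X -> Pr Y -> Pr (fun t w => X t w + Y t w).
  move=> [c Xc] [e Ye]; exists (c + e) => t w ht.
  by rewrite (le_trans (ler_normD _ _))// lerD// ?Xc ?Ye.
have Pr_coef (h : Omega -> R) (b : R -> bool) : (exists c, forall w, `|h w| <= c) ->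
    Pr (fun t w => h w * (b t)%:R).
  move=> [c hc]; exists c => t w ht; rewrite normrM.
  by case: (b t); rewrite ?normr1 ?mulr1// normr0 mulr0 (le_trans _ (hc w)).
apply: (PrD _ _); first by apply: Pr_coef; have [] := el_initP K.
apply: (process_sum_ind (Pr := Pr) (index_enum _) (f := fun k : 'I_(el_size K) =>
    fun t w => el_coef K k w * (el_left K k < t <= el_right K k)%R%:R)).
- by exists 0 => t w; rewrite normr0.
- exact: PrD.
move=> k; apply: (Pr_coef (el_coef K k) (fun t => el_left K k < t <= el_right K k)).
by have [] := el_coefP (ltn_ord k).
Qed.

(** The limit constructor carries adaptedness, path regularity and a uniform bound, so a case
    distinction suffices. *)
Lemma bounded_integralP M H X : adapted T F M -> cadlag T M ->
  bounded_integral P T F M H X ->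
  [/\ adapted T F X, cadlag T X &
      exists c, forall t w, 0 <= t <= T -> `|H t w| <= c].
Proof.
move=> aM cM; case.
- move=> K; split; [exact: adapted_el_integral|exact: cadlag_el_integral|].
  exact: bounded_el_process.
- move=> Hn Xn {}H {}X c _ Hnc HnH aX cX _; split=> //; exists c => t w ht.
  have nH : `|Hn n t w| @[n --> \oo] --> `|H t w|.
    by apply: cvg_norm; exact: HnH.
  rewrite -(cvg_lim _ nH)//; apply: limr_le; first by apply/cvg_ex; eexists; exact: nH.
  by apply: nearW => n; exact: Hnc.
Qed.

Lemma outer_prob_leU (B C : set Omega) (b c : R) :
  outer_prob_le P B b -> outer_prob_le P C c -> outer_prob_le P (B `|` C) (b + c).
Proof.
move=> [B' [mB PB BB']] [C' [mC PC CC']]; exists (B' `|` C'); split.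
- exact: measurableU.
- rewrite EFinD (le_trans (measureU2 _ _ _))//.
  exact: leeD.
- exact: setUSS.
Qed.

Lemma outer_prob_leS (B C : set Omega) (b : R) :
  B `<=` C -> outer_prob_le P C b -> outer_prob_le P B b.
Proof.
by move=> BC [C' [mC PC CC']]; exists C'; split=> //; exact: subset_trans CC'.
Qed.

Lemma ucp_cvg_lin (Xn : nat -> process) X Y (a : R) :
  ucp_cvg P T Xn X -> ucp_cvg P T (fun n t w => Y t w + a * Xn n t w)
                                  (fun t w => Y t w + a * X t w).
Proof.
move=> XnX eps delta eps0 delta0.
(* The added 1 keeps the divisor positive when a = 0. *)
have a0 : 0 < `|a| + 1 by rewrite ltr_wpDl.
have := XnX _ _ (divr_gt0 eps0 a0) delta0; apply: filterS => n.
apply: outer_prob_leS => w [t ht b]; exists t => //; rewrite ltr_pdivrMr//.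
apply: (lt_le_trans b).
rewrite (_ : _ - _ = a * (Xn n t w - X t w)); last by ring.
by rewrite normrM mulrC ler_wpM2l// lerDl.
Qed.

(** With one summand fixed, a dominated limit in the other remains a dominated limit. The induction
    is on the first integral, and its elementary base case is an induction on the second. *)
Lemma bounded_integral_lin M H X H' X' (a : R) :
  adapted T F M -> cadlag T M ->
  bounded_integral P T F M H X -> bounded_integral P T F M H' X' ->
  bounded_integral P T F M (fun t w => H t w + a * H' t w)
                           (fun t w => X t w + a * X' t w).
Proof.
move=> aM cM HX HX'; have [aX' cX' [c' Hc']] := bounded_integralP aM cM HX'.
elim: HX => {H X} [K|Hn Xn H X c _ IH Hnc HnH aX cX XnX].
- have [aX cX [c Hc]] := bounded_integralP aM cM (bounded_integral_elementary P M K).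
  elim: HX' => {H' X' aX' cX' c' Hc'} [L|Hn Xn H X e _ IH Hnc HnH aY cY XnX].
    have [N [<- <-]] := elementary_lin K L a.
    exact: bounded_integral_elementary.
  apply: (bounded_integral_limit (c := c + `|a| * e) IH).
  + move=> n t w ht; rewrite (le_trans (ler_normD _ _))// lerD//; first exact: Hc.
    by rewrite normrM ler_wpM2l// Hnc.
  + move=> t w ht; apply: cvgD; first exact: cvg_cst.
    by apply: cvgM; [exact: cvg_cst|exact: HnH].
  + exact: adapted_lin.
  + exact: cadlag_lin.
  + exact: ucp_cvg_lin.
- apply: (bounded_integral_limit (c := c + `|a| * c') IH).
  + move=> n t w ht; rewrite (le_trans (ler_normD _ _))// lerD//; first exact: Hnc.
    by rewrite normrM ler_wpM2l// Hc'.
  + move=> t w ht; apply: cvgD; first exact: HnH.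
    by apply: cvg_cst.
  + exact: adapted_lin.
  + exact: cadlag_lin.
  + have := ucp_cvg_lin (fun t w => a * X' t w) 1 XnX.
    congr (ucp_cvg P T _ _); last by apply/funext => t; apply/funext => w; ring.
    by apply/funext => n; apply/funext => t; apply/funext => w; ring.
Qed.

End BoundedIntegrals.

(** * Functions vanishing in outer probability *)

Section OuterNull.
Context {disp : measure_display} {Omega : measurableType disp} {R : realType}.
Variable P : probability Omega R.

(** Vanishing almost everywhere, in the form in which ucp and Emery limits deliver it. *)
Definition outer_null (g : Omega -> R) : Prop := forall eps delta : R,
  0 < eps -> 0 < delta -> outer_prob_le P [set w | eps < `|g w|] delta.

Lemma outer_null_ae (g : Omega -> R) :
  outer_null g -> {ae P, forall w, g w = 0}.
Proof.
move=> g0.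
have: forall k, {ae P, forall w, ~ (k.+1%:R^-1 < `|g w|)}.
  move=> k.
  (* Intersecting covers of probability at most 1/(n+1) yields a measurable null cover. *)
  have /choice[C CP] : forall n : nat, exists C, [/\ measurable C,
      (P C <= (n.+1%:R^-1)%:E)%E & [set w | k.+1%:R^-1 < `|g w|] `<=` C].
    by move=> n; apply: g0; rewrite invr_gt0.
  have mC : measurable (\bigcap_n C n).
    by apply: bigcap_measurableType => n _; have [] := CP n.
  exists (\bigcap_n C n); split => //.
  - apply/eqP; rewrite eq_le measure_ge0 andbT; apply/lee_addgt0Pr => e e0.
    rewrite add0e; near \oo => n; have [mCn PCn _] := CP n.
    have : (P (\bigcap_n C n) <= P (C n))%E.
      by apply: le_measure; rewrite ?inE//; exact: bigcap_inf.
    move=> /le_trans; apply; apply: (le_trans PCn); rewrite lee_fin; apply/ltW.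
    by near: n; exact: near_infty_natSinv_lt (PosNum e0).
  - by move=> w /= /contrapT gw n _; have [_ _] := CP n; apply.
move/ae_foralln; apply: filterS => w gw; apply/eqP/negPn/negP.
rewrite -normr_gt0 => gw0; near \oo => n; apply: (gw n).
by near: n; exact: near_infty_natSinv_lt (PosNum gw0).
Unshelve. all: by end_near. Qed.

Lemma outer_nullD (g h : Omega -> R) :
  outer_null g -> outer_null h -> outer_null (fun w => g w + h w).
Proof.
move=> g0 h0 e d e0 d0; rewrite (splitr d).
apply: outer_prob_leS (outer_prob_leU (g0 (e / 2) (d / 2) _ _) (h0 (e / 2) (d / 2) _ _));
  rewrite ?divr_gt0// => w /= ew; apply/orP; rewrite -implyNb -leNgt; apply/implyP => le.
rewrite ltNge; apply/negP => le'; move: ew; apply/negP; rewrite -leNgt (splitr e).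
by rewrite (le_trans (ler_normD _ _))// lerD.
Qed.

Lemma outer_null0 : outer_null (fun=> 0).
Proof.
move=> e d e0 d0; exists set0; split=> //; first by rewrite measure0 lee_fin ltW.
by move=> w /=; rewrite normr0 ltNge (ltW e0).
Qed.

Lemma outer_null_cvg (gn : nat -> Omega -> R) (g : Omega -> R) :
  (forall n, outer_null (gn n)) ->
  (forall e d, 0 < e -> 0 < d -> \forall n \near \oo,
     outer_prob_le P [set w | e < `|gn n w - g w|] d) ->
  outer_null g.
Proof.
move=> gn0 gng e d e0 d0.
have e20 : 0 < e / 2 by rewrite divr_gt0.
have d20 : 0 < d / 2 by rewrite divr_gt0.
near \oo => n.
have gngn : outer_prob_le P [set w | e / 2 < `|gn n w - g w|] (d / 2).
  by near: n; exact: gng.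
rewrite (splitr d).
apply: outer_prob_leS (outer_prob_leU (gn0 n _ _ e20 d20) gngn) => w /= ew.
have [?|le] := ltP (e / 2) `|gn n w|; [by left|right].
rewrite ltNge; apply/negP => le'; move: ew; apply/negP; rewrite -leNgt.
rewrite (_ : g w = gn n w - (gn n w - g w)); last by ring.
by rewrite (splitr e) (le_trans (ler_normB _ _))// lerD.
Unshelve. all: by end_near. Qed.

End OuterNull.

(** * Linearity and initial values of stochastic integrals and wealth processes *)

Section Wealth.
Context {disp : measure_display} {Omega : measurableType disp} {R : realType}.
Variables (P : probability Omega R) (T : R) (F : R -> set (set Omega)).
Hypotheses (T_gt0 : 0 < T)
  (sF : forall t, 0 <= t <= T -> sigma_algebra setT (F t))
  (monoF : forall s t, 0 <= s -> s <= t -> t <= T -> F s `<=` F t).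
Local Notation process := (R -> Omega -> R).

Lemma semimartingale_adapted (X : process) :
  semimartingale P T F X -> adapted T F X.
Proof.
move=> [M [A [[aM _ _] [aA _ _] XMA]]].
apply: (eq_adapted _ (adapted_lin sF 1 aM aA)) => t w ht.
by rewrite XMA// mul1r.
Qed.

Lemma semimartingale_cadlag (X : process) :
  semimartingale P T F X -> cadlag T X.
Proof.
move=> [M [A [[_ cM _] [_ cA _] XMA]]].
apply: (eq_cadlag _ (cadlag_lin 1 cM cA)) => t w ht.
by rewrite XMA// mul1r.
Qed.

(** Test integrals are linear in the integrator, and both estimates, being uniform over K, can be
    used with the same K. *)
Lemma emery_cvg_lin (Xn Yn : nat -> process) (X Y : process) (a : R) :
  emery_cvg P T F Xn X -> emery_cvg P T F Yn Y ->
  emery_cvg P T F (fun n t w => Xn n t w + a * Yn n t w)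
                  (fun t w => X t w + a * Y t w).
Proof.
move=> XnX YnY eps delta eps0 delta0.
have a0 : 0 < 2 * (`|a| + 1) by rewrite mulr_gt0// ltr_wpDl.
have eps20 : 0 < eps / 2 by rewrite divr_gt0.
have delta20 : 0 < delta / 2 by rewrite divr_gt0.
have := YnY _ _ (divr_gt0 eps0 a0) delta20; have := XnX _ _ eps20 delta20.
apply: filterS2 => n nX nY K K1; rewrite (splitr delta).
apply: outer_prob_leS (outer_prob_leU (nX K K1) (nY K K1)) => w [t ht].
rewrite (_ : (fun s v => _) = (fun s v => (Xn n s v - X s v) +
  a * (Yn n s v - Y s v))); last first.
  by apply/funext => s; apply/funext => v; ring.
rewrite el_integral_lin.
set x := el_init K w * (Xn n 0 w - X 0 w) +
  el_integral K (fun s v => Xn n s v - X s v) t w.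
set y := el_init K w * (Yn n 0 w - Y 0 w) +
  el_integral K (fun s v => Yn n s v - Y s v) t w.
rewrite (_ : _ + _ = x + a * y); last by rewrite /x /y; ring.
move=> epsxy; have [xe|xe] := ltP (eps / 2) `|x|; first by left; exists t.
right; exists t => //; rewrite -/y ltr_pdivrMr// ltNge; apply/negP => ye.
move: epsxy; apply/negP; rewrite -leNgt (le_trans (ler_normD _ _))//.
rewrite [leRHS](splitr eps) lerD// normrM ler_pdivlMr// (le_trans _ ye)//.
by have := normr_ge0 y; lra.
Qed.

Variables (d : nat) (S : 'I_d -> process).
Hypothesis semiS : forall i, semimartingale P T F (S i).

Lemma stochastic_integral_lin (H K : 'I_d -> process) (X Y : process) (a : R) :
  stochastic_integral P T F S H X -> stochastic_integral P T F S K Y ->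
  stochastic_integral P T F S (fun i t w => H i t w + a * K i t w)
                              (fun t w => X t w + a * Y t w).
Proof.
move=> [pH aX cX [Hn [Xn [HnXn HnH XnX]]]] [pK aY cY [Kn [Yn [KnYn KnK YnY]]]].
split; [by move=> i; exact: predictable_lin|exact: adapted_lin|exact: cadlag_lin|].
exists (fun n i t w => Hn n i t w + a * Kn n i t w).
exists (fun n t w => Xn n t w + a * Yn n t w); split; last exact: emery_cvg_lin.
- move=> n; have [Z HZ XZ] := HnXn n; have [Z' KZ' YZ'] := KnYn n.
  exists (fun i t w => Z i t w + a * Z' i t w).
    move=> i; apply: bounded_integral_lin => //.
    + exact: semimartingale_adapted.
    + exact: semimartingale_cadlag.
  by move=> t w ht; rewrite XZ// YZ'// mulr_sumr big_split.
- move=> i t w ht; apply: cvgD; first exact: HnH.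
  by apply: cvgM; [exact: cvg_cst|exact: KnK].
Qed.

(** Elementary integrals vanish at time 0, and ucp convergence controls that time. *)
Lemma bounded_integral_at0 (M H X : process) :
  bounded_integral P T F M H X -> outer_null P (X 0).
Proof.
elim => [K|Hn Xn {}H {}X c _ IH _ _ _ _ XnX].
  rewrite (_ : el_integral K M 0 = fun=> 0); first exact: outer_null0.
  apply/funext => w; rewrite /el_integral big1// => k _.
  have [l0 lr _] := el_timeP (ltn_ord k).
  by rewrite (min_r l0) (min_r (le_trans l0 lr)) subrr mulr0.
apply: (outer_null_cvg IH) => e d' e0 d0; have := XnX _ _ e0 d0.
apply: filterS => n; apply: outer_prob_leS => w /= ew.
by exists 0 => //; rewrite lexx ltW.
Qed.

Lemma stochastic_integral_at0 (H : 'I_d -> process) (X : process) :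
  stochastic_integral P T F S H X -> {ae P, forall w, X 0 w = 0}.
Proof.
move=> [_ _ _ [Hn [Xn [HnXn _ XnX]]]]; apply: outer_null_ae.
have T0 : 0 <= (0 : R) <= T by rewrite lexx ltW.
have Xn0 n : outer_null P (Xn n 0).
  have [Y HY XY] := HnXn n.
  rewrite (_ : Xn n 0 = fun w => \sum_(i <- index_enum 'I_d) Y i 0 w); last first.
    by apply/funext => w; rewrite XY.
  apply: (process_sum_ind (Pr := fun Z => outer_null P (Z 0))).
  - exact: outer_null0.
  - by move=> *; exact: outer_nullD.
  - by move=> i; exact: bounded_integral_at0 (HY i).
have b1 : bounded_rv (F 0) (fun=> 1 : R).
  split; last by exists 1 => w; rewrite normr1.
  by move=> B mB; exact: (sigma_algebra_preimage_cst (sF T0)).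
have timeP k : (k < 0)%N -> [/\ 0 <= (0 : R), (0 : R) <= 0 & 0 <= T] by [].
have coefP k : (k < 0)%N -> bounded_rv (F 0) (fun=> 0 : R) by [].
(* Tested against the indicator of time 0, Emery convergence becomes convergence of the initial
   values in outer probability. *)
pose K : elementary T F := @Elementary disp Omega R T F _ 0%N (fun=> 0) (fun=> 0)
  (fun _ _ => 0) b1 timeP coefP.
apply: (outer_null_cvg Xn0) => e d' e0 d0; have := XnX _ _ e0 d0.
apply: filterS => n /(_ K) nX.
have {nX} := nX; case.
  move=> t w _; rewrite /el_process/= big_ord0 addr0 mul1r.
  by case: (t == 0); rewrite ?normr1 ?normr0.
move=> C [mC PC CC]; exists C; split=> // w /= ew; apply: CC.
by exists 0 => //=; rewrite mul1r /el_integral big_ord0 addr0.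
Qed.

Lemma wealth_lin (x y a : R) (X Y : process) :
  wealth P T F S x X -> wealth P T F S y Y ->
  wealth P T F S (x + a * y) (fun t w => X t w + a * Y t w).
Proof.
move=> [H HX] [K KY]; exists (fun i t w => H i t w + a * K i t w).
have := stochastic_integral_lin a HX KY; congr (stochastic_integral _ _ _ _ _ _).
by apply/funext => t; apply/funext => w; ring.
Qed.

Lemma wealthD (x c : R) (X : process) :
  wealth P T F S x X -> wealth P T F S (x + c) (fun t w => X t w + c).
Proof.
move=> [H HX]; exists H; move: HX; congr (stochastic_integral _ _ _ _ _ _).
by apply/funext => t; apply/funext => w; ring.
Qed.

Lemma wealthZ (x a : R) (X : process) :
  wealth P T F S x X -> wealth P T F S (a * x) (fun t w => a * X t w).
Proof.
move=> wX; have := wealth_lin (a - 1) wX wX.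
rewrite (_ : x + (a - 1) * x = a * x); last by ring.
congr (wealth _ _ _ _ _ _).
by apply/funext => t; apply/funext => w; ring.
Qed.

Lemma wealth_at0 (x : R) (X : process) :
  wealth P T F S x X -> {ae P, forall w, X 0 w = x}.
Proof.
move=> [H /stochastic_integral_at0]; apply: filterS => w /eqP.
by rewrite subr_eq0 => /eqP.
Qed.

Lemma wealth_cadlag (x : R) (X : process) :
  wealth P T F S x X -> cadlag T X.
Proof.
move=> [H [_ _ cX _]].
have := cadlag_lin 1 cX (cadlag_cst T (fun=> x)).
by apply: eq_cadlag => t w _; ring.
Qed.

Lemma wealth_adapted (x : R) (X : process) :
  wealth P T F S x X -> adapted T F X.
Proof.
move=> [H [_ aX _ _]].
have := adapted_lin sF 1 aX (adapted_cst sF x).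
by apply: eq_adapted => t w _; ring.
Qed.

End Wealth.

(** * Integral inequalities without measurability; absolute continuity *)

Section NullSets.
Context {disp : measure_display} {Omega : measurableType disp} {R : realType}.
Local Open Scope ereal_scope.

Lemma dominates_ae (mu nu : {measure set Omega -> \bar R}) (p : Omega -> Prop) :
  nu `<< mu -> {ae mu, forall w, p w} -> {ae nu, forall w, p w}.
Proof.
by move=> /null_content_dominatesP numu [A [mA A0 pA]]; exists A; split=> //; exact: numu.
Qed.

Section LowerIntegral.
Import HBNNSimple.
Variable mu : {measure set Omega -> \bar R}.

(* The integral of an arbitrary nonnegative function is the supremum of the     *)
(* integrals of the simple functions below it; cut these off on the null set.   *)
Lemma ae_ge0_le_lower_integral (f g : Omega -> \bar R) :
  (forall w, 0 <= f w) -> (forall w, 0 <= g w) ->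
  {ae mu, forall w, f w <= g w} -> \int[mu]_w f w <= \int[mu]_w g w.
Proof.
move=> f0 g0 [N [mN N0 fgN]]; rewrite !ge0_integralTE//.
apply: ge_ereal_sup => _ /= [h hf <-].
have mNC : measurable (~` N) by exact: measurableC.
apply: (@le_trans _ _ (sintegral mu (proj_nnsfun h mNC))).
  rewrite -!integralT_nnsfun le_eqVlt; apply/orP; left; apply/eqP.
  apply: ge0_ae_eq_integral => //.
  - exact/measurable_EFinP.
  - exact/measurable_EFinP.
  - by move=> w _; rewrite lee_fin; exact: fun_ge0.
  - by move=> w _; rewrite lee_fin; exact: fun_ge0.
  exists N; split=> // w /= hw; apply: contrapT => Nw; apply: hw => _.
  by congr EFin; rewrite /= mindicE mem_set ?mulr1.
apply: ereal_sup_ubound; exists (proj_nnsfun h mNC) => //= w.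
rewrite mindicE; case: (boolP (w \in ~` N)) => [|_]; last by rewrite mulr0.
rewrite inE => Nw; rewrite mulr1 (le_trans (hf w))//.
by apply: contrapT => fgw; apply: Nw; exact: fgN.
Qed.

Lemma ae_le_integral (A : set Omega) (f g : Omega -> \bar R) :
  {ae mu, forall w, A w -> f w <= g w} ->
  \int[mu]_(w in A) f w <= \int[mu]_(w in A) g w.
Proof.
rewrite integral_mkcond [leRHS]integral_mkcond => fg.
have {}fg : {ae mu, forall w, (f \_ A) w <= (g \_ A) w}.
  move: fg; apply: filterS => w fgw; rewrite !patchE.
  by case: ifPn => // /set_mem /fgw.
rewrite integralE [leRHS]integralE; apply: leeB; apply: ae_ge0_le_lower_integral => //;
  move: fg; apply: filterS => w fgw; rewrite ?funeposE ?funenegE; apply: le_max2 => //.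
by rewrite leeN2.
Qed.

Lemma integrable_funeposneg (f : Omega -> \bar R) : measurable_fun setT f ->
  \int[mu]_w f^\+ w < +oo -> \int[mu]_w f^\- w < +oo -> mu.-integrable setT f.
Proof.
move=> mf fp fn; apply/integrableP; split=> //.
rewrite (_ : (fun w => _) = f^\+ \+ f^\-); last by rewrite -fune_abse.
rewrite ge0_integralD//; first exact: lte_add_pinfty.
- exact: measurable_funepos.
- exact: measurable_funeneg.
Qed.

End LowerIntegral.

Lemma le_utility_expectation (Q : probability Omega R) (f g : Omega -> \bar R) :
  {ae Q, forall w, f w <= g w} -> utility_expectation Q f <= utility_expectation Q g.
Proof.
move=> fg; rewrite /utility_expectation; case: ifPn => [_|foo]; first exact: leNye.
have gf : \int[Q]_w g^\- w <= \int[Q]_w f^\- w.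
  apply: ae_ge0_le_lower_integral => //; move: fg; apply: filterS => w fgw.
  by rewrite !funenegE; apply: le_max2 => //; rewrite leeN2.
rewrite ifN; last first.
  by apply: contra foo => /eqP goo; move: gf; rewrite goo leye_eq.
by apply: ae_le_integral; move: fg; exact: filterS.
Qed.

Lemma eq_utility_expectation (Q : probability Omega R) (f g : Omega -> \bar R) :
  {ae Q, forall w, f w = g w} -> utility_expectation Q f = utility_expectation Q g.
Proof.
move=> fg; apply/eqP; rewrite eq_le; apply/andP; split;
  by apply: le_utility_expectation; move: fg; apply: filterS => w ->.
Qed.

(** The epsilon-delta form of absolute continuity, obtained from the variation of [nu] regarded as a
    charge. *)
Lemma dominates_small (mu : {measure set Omega -> \bar R}) (nu : probability Omega R)
    (e : R) : nu `<< mu -> (0 < e)%R ->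
  exists2 d : R, (0 < d)%R &
    forall A, measurable A -> mu A < d%:E -> nu A < e%:E.
Proof.
move=> numu e0.
have [A [B AB]] := Hahn_decomposition (charge_of_finite_measure nu).
have [d [d0 dP]] := charge_variation_continuous AB numu e0.
exists d => // C mC Cd; apply: le_lt_trans (dP _ mC Cd).
by apply: le_trans (abse_charge_variation AB mC); rewrite lee_abs.
Qed.

End NullSets.

(** * An enumeration of the positive rationals *)

Section PositiveRationals.
Context {R : realType}.

(** Codes of no rational, or of a nonpositive one, are sent to 1, so that every value is
    positive. *)
Definition posrat (n : nat) : R :=
  let r := ratr (odflt 1%Q (unpickle n)) in if 0 < r then r else 1.

Lemma posrat_gt0 n : 0 < posrat n.
Proof. by rewrite /posrat; case: ifPn. Qed.

Lemma posrat_dense (x y : R) : 0 <= x -> x < y -> exists n, x < posrat n < y.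
Proof.
move=> x0 /rat_in_itvoo[r /itvP rxy]; exists (pickle r).
by rewrite /posrat pickleK/= (le_lt_trans x0)// !rxy.
Qed.

End PositiveRationals.

(** * Measurability, concavity and Fenchel bounds for utility fields *)

Section UtilityFields.
Context {disp : measure_display} {Omega : measurableType disp} {R : realType}.
Variable U : Omega -> R -> \bar R.
Hypothesis utU : utility_field U.
Local Open Scope ereal_scope.

Lemma utility_le w (x y : R) : (0 <= x)%R -> (x <= y)%R -> U w x <= U w y.
Proof.
move=> x0; rewrite le_eqVlt => /predU1P[->//|xy].
by apply/ltW; exact: (uf_increasing utU).
Qed.

Lemma utility_fin_num w (x : R) : (0 < x)%R -> U w x \is a fin_num.
Proof.
move=> x0; rewrite fin_real// (uf_lty utU) ?ltW// andbT.
by apply: le_lt_trans (uf_increasing utU w (lexx 0%R) x0); rewrite leNye.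
Qed.

Lemma utility_right_cvg w (x : R) : (0 <= x)%R -> U w z @[z --> x^'+] --> U w x.
Proof.
rewrite le_eqVlt => /predU1P[<-|x0]; first exact: (uf_zero utU).
rewrite -(fineK (utility_fin_num w x0)); apply/fine_cvgP; split.
  near=> z; apply: utility_fin_num; apply: (lt_trans x0).
  by near: z; exact: nbhs_right_gt.
apply: cvg_at_right_filter; have [dU _] := uf_C1 utU w x0.
exact/differentiable_continuous/derivable1_diffP.
Unshelve. all: by end_near. Qed.

(** Monotonicity and right-continuity in x. Since U is measurable in w only for fixed x, this
    countable infimum is what makes U measurable along a random x. *)
Lemma utility_inf_posrat w (x : R) : (0 <= x)%R ->
  U w x = einfs (fun n => if (x < posrat n)%R then U w (posrat n) else +oo) 0%N.
Proof.
move=> x0; apply/eqP; rewrite eq_le; apply/andP; split.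
  apply: le_ereal_inf_tmp => _ /= [n _ <-]; case: ifPn => [xn|_]; last by rewrite leey.
  exact/utility_le/ltW.
rewrite leNgt; apply/negP => Uinf.
have Hnear := @utility_right_cvg w x x0 _ (open_ereal_lt' Uinf).
have : \forall z \near x^'+, (x < z)%R /\ U w z < einfs (fun n =>
    if (x < posrat n)%R then U w (posrat n) else +oo) 0%N.
  near=> z; split; near: z; first exact: nbhs_right_gt.
  exact: Hnear.
case=> d /= d0 dP.
have [|n /andP[xn nd]] := posrat_dense x0 (_ : x < x + d)%R; first by rewrite ltrDl.
have [|_] := dP (posrat n) _ xn.
  by rewrite /ball_/= ltr_distlC nd andbT; lra.
apply/negP; rewrite -leNgt; apply: ereal_inf_lbound => /=.
by exists n => //; rewrite xn.
Unshelve. all: by end_near. Qed.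

Lemma measurable_utility (X : Omega -> R) : (forall w, (0 <= X w)%R) ->
  measurable_fun setT X -> measurable_fun setT (fun w => U w (X w)).
Proof.
move=> X0 mX; under eq_fun do rewrite utility_inf_posrat//.
apply: measurable_fun_einfs => n; apply: measurable_fun_ifT => //.
- exact: measurable_fun_ltr.
- by apply: (uf_measurable utU); exact/ltW/posrat_gt0.
Qed.

(** Both x + e and k lie between x and k + e, with exchanged weights l and 1 - l for l = e / (k + e
    - x); the claim is the sum of the two concavity inequalities. *)
Lemma utility_increment w (x k e : R) : (0 <= x)%R -> (x <= k)%R -> (0 < k)%R ->
  (0 < e)%R -> U w x + (U w (k + e)%R - U w k) <= U w (x + e)%R.
Proof.
(* For x = k the weight [l] would be 1, which strict concavity excludes; the claim is then an
   identity. *)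
move=> x0; rewrite le_eqVlt => /predU1P[<- {}x_gt0 e0|xk k0 e0].
  have fx := utility_fin_num w x_gt0.
  by rewrite addeC subeK.
have fk := utility_fin_num w k0.
have fke : U w (k + e)%R \is a fin_num by apply: utility_fin_num; rewrite addr_gt0.
have fxe : U w (x + e)%R \is a fin_num by apply: utility_fin_num; rewrite ltr_wpDl.
have [Ux|Ux] := eqVneq (U w x) -oo; first by rewrite Ux addNye// leNye.
have fx : U w x \is a fin_num.
  by rewrite fin_real// ltNye Ux (uf_lty utU).
pose l := (e / (k + e - x))%R.
have ke : (0 < k + e - x)%R by lra.
have l01 : (0 < l < 1)%R by rewrite divr_gt0//= ltr_pdivrMr// mul1r; lra.
have l01' : (0 < 1 - l < 1)%R by move: l01; lra.
have xke : x != (k + e)%R by rewrite lt_eqF//; lra.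
have ke0 : (0 <= k + e)%R by lra.
have := ltW (uf_concave utU w x0 ke0 xke l01).
have := ltW (uf_concave utU w x0 ke0 xke l01').
rewrite (_ : (1 - l) * x + (1 - (1 - l)) * (k + e) = x + e)%R; last first.
  by rewrite /l; field; rewrite gt_eqF.
rewrite (_ : l * x + (1 - l) * (k + e) = k)%R; last first.
  by rewrite /l; field; rewrite gt_eqF.
rewrite -(fineK fx) -(fineK fk) -(fineK fke) -(fineK fxe) !lee_fin.
by lra.
Qed.

(** The increment [phi] of U over [k, k + e] is positive, so it exceeds some h > 0 on an event [B n]
    of Q0-probability above 3/4. Removing {X > k} leaves at least 1/2 under Q0, hence at least d
    under Q, and there the gain is at least h. The constant h d does not depend on X. *)
Lemma utility_gap (Q Q0 : probability Omega R) (k e : R) : Q0 `<< Q ->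
  (0 < k)%R -> (0 < e)%R ->
  exists2 c : R, (0 < c)%R & forall X : Omega -> R, (forall w, (0 <= X w)%R) ->
    measurable_fun setT X -> Q0 [set w | (k < X w)%R] <= (4^-1)%:E ->
    Q.-integrable setT (fun w => U w (X w)) ->
    Q.-integrable setT (fun w => U w (X w + e)%R) ->
    \int[Q]_w U w (X w) + c%:E <= \int[Q]_w U w (X w + e)%R.
Proof.
move=> Q0Q k0 e0.
have ke0 : (0 < k + e)%R by rewrite addr_gt0.
pose phi w := (fine (U w (k + e)%R) - fine (U w k))%R.
have mphi : measurable_fun setT phi.
  apply: measurable_funB; apply: measurableT_comp => //;
    by apply: (uf_measurable utU); exact: ltW.
have phi_gt0 w : (0 < phi w)%R.
  rewrite subr_gt0 fine_lt ?utility_fin_num//.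
  by apply: (uf_increasing utU); [exact: ltW|rewrite ltrDl].
pose B n := [set w | (n.+1%:R^-1 < phi w)%R].
have mB n : measurable (B n).
  by rewrite -[B n]setTI; exact: (measurable_fun_ltr (measurable_cst _) mphi).
have ndB : nondecreasing_seq B.
  move=> n m nm; apply/subsetPset => w; apply: le_lt_trans.
  by rewrite lef_pV2 ?posrE// ler_nat.
have BT : \bigcup_n B n = setT.
  apply/seteqP; split=> // w _; near \oo => n; exists n => //.
  by near: n; exact: near_infty_natSinv_lt (PosNum (phi_gt0 w)).
have [n Bn] : exists n, (3 / 4)%:E < Q0 (B n).
  have : Q0 (B n) @[n --> \oo] --> Q0 (\bigcup_n B n).
    by apply: nondecreasing_cvg_mu => //; exact: bigcup_measurable.
  rewrite BT probability_setT => B1.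
  have lt1 : (3 / 4)%:E < 1 :> \bar R by rewrite lte_fin; lra.
  have [N _ /(_ N (leqnn N))] := B1 _ (open_ereal_gt' lt1).
  by exists N.
have h0 : (0 < 2^-1 :> R)%R by [].
have [d d0 dP] := dominates_small Q0Q h0.
pose h := (n.+1%:R^-1 : R)%R.
have h_gt0 : (0 < h)%R by rewrite invr_gt0.
exists (h * d)%R; first by rewrite mulr_gt0.
move=> X X0 mX Xk iUX iUXe.
have mXk : measurable [set w | (k < X w)%R].
  by rewrite -[[set _ | _]]setTI; exact: (measurable_fun_ltr (measurable_cst _) mX).
pose D := B n `\` [set w | (k < X w)%R].
have mD : measurable D by exact: measurableD.
have dD : d%:E <= Q D.
  rewrite leNgt; apply/negP => /(dP _ mD); apply/negP; rewrite -leNgt.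
  have BD : Q0 (B n) <= Q0 D + Q0 [set w | (k < X w)%R].
    apply: le_trans (measureU2 _ mD mXk); apply: le_measure; rewrite ?inE//.
      exact: measurableU.
    by move=> w Bw; have [kX|kX] := boolP (k < X w)%R; [right|left; split => //; exact/negP].
  have fD : Q0 D \is a fin_num by exact: fin_num_measure.
  move: (le_trans (ltW Bn) (le_trans BD (leeD2l _ Xk))).
  by rewrite -(fineK fD) -EFinD !lee_fin; lra.
pose g w := (h * \1_D w)%:E.
have ig : Q.-integrable setT g.
  rewrite (_ : g = fun w => h%:E * (\1_D w)%:E) //.
  by apply: integrableZl => //; exact: integrable_indic.
apply: (@le_trans _ _ (\int[Q]_w (U w (X w) + g w))).
  rewrite integralD//; apply: leeD2l.
  rewrite (_ : g = fun w => h%:E * (\1_D w)%:E) // integralZl//; last exact: integrable_indic.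
  by rewrite integral_indic// setIT EFinM lee_pmul2l ?fin_numElt ?ltry ?ltNyr ?lte_fin.
apply: le_integral => //; first exact: integrableD.
move=> w _; rewrite /g indicE; have [wD|wD] := boolP (w \in D); last first.
  by rewrite mulr0 adde0 utility_le// lerDl ltW.
move: wD; rewrite inE => -[Bw /= /negP]; rewrite -leNgt => Xwk.
apply: le_trans (utility_increment w (X0 w) Xwk k0 e0); apply: leeD2l.
rewrite mulr1 -(fineK (utility_fin_num w k0)) -(fineK (utility_fin_num w ke0)).
by rewrite -EFinB lee_fin ltW.
Unshelve. all: by end_near. Qed.

(* Fenchel: U(X) <= U(r) <= V(Y) + r Y for rational r in (X, X + 1); the       *)
(* rationals r keep the upper bound measurable.                                 *)
Lemma utility_bound (Q : probability Omega R) (Y : Omega -> R) :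
  measurable_fun setT Y ->
  conjugate_expectation Q (fun w => conjugate U w (Y w)) < +oo ->
  exists2 c : \bar R, c < +oo & forall X : Omega -> R, (forall w, (0 <= X w)%R) ->
    measurable_fun setT X ->
    \int[Q]_w (fun w => U w (X w))^\+ w <=
    c + \int[Q]_w `|(X w + 1) * Y w|%:E.
Proof.
move=> mY; rewrite /conjugate_expectation; case: ifPn => // Voo _.
(* A measurable minorant of the conjugate at Y: the supremum is restricted to countably many
   points. *)
pose G w := esups (fun n => U w (posrat n) - (posrat n * Y w)%:E) 0%N.
have mG : measurable_fun setT G.
  apply: measurable_fun_esups => n; apply: emeasurable_funB.
    by apply: (uf_measurable utU); exact/ltW/posrat_gt0.
  by apply/measurable_EFinP; exact: measurable_funM.
exists (\int[Q]_w G^\+ w).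
  apply: (@le_lt_trans _ _ (\int[Q]_w (fun w => conjugate U w (Y w))^\+ w)); last first.
    by rewrite ltey.
  apply: ae_ge0_le_lower_integral => //.
  apply: aeW => w; rewrite !funeposE.
  apply: le_max2 => //; apply: ge_ereal_sup => _ /= [n _ <-].
  by apply: ereal_sup_ubound => /=; exists (posrat n) => //; exact: posrat_gt0.
move=> X X0 mX.
have mXY : measurable_fun setT (fun w => `|(X w + 1) * Y w|%:E).
  apply/measurable_EFinP; apply: measurableT_comp => //.
  by apply: measurable_funM => //; exact: measurable_funD.
rewrite -ge0_integralD//; last exact: measurable_funepos.
apply: ae_ge0_le_lower_integral => //.
  by move=> w; rewrite adde_ge0.
apply: aeW => w.
have [|n /andP[Xn nX]] := posrat_dense (X0 w) (_ : X w < X w + 1)%R.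
  by rewrite ltrDl.
have n0 : (0 < posrat n :> R)%R := posrat_gt0 n.
have UG : U w (X w) <= G w + `|(X w + 1) * Y w|%:E.
  apply: (le_trans (utility_le w (X0 w) (ltW Xn))).
  apply: (@le_trans _ _ (G w + (posrat n * Y w)%:E)).
    by rewrite -leeBlDr//; apply: ereal_sup_ubound => /=; exists n.
  apply: leeD2l; rewrite lee_fin (le_trans (ler_norm _))// !normrM ler_wpM2r//.
  by rewrite !gtr0_norm ?ltW// (lt_trans n0).
rewrite !funeposE ge_max; apply/andP; split; last by rewrite adde_ge0// le_max lexx orbT.
by apply: (le_trans UG); apply: leeD2r; rewrite le_max lexx.
Qed.

End UtilityFields.

(** * Nonnegativity and bounds from the separating measure; replication *)

Section Market.
Context {disp : measure_display} {Omega : measurableType disp} {R : realType}.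
Variables (P : probability Omega R) (T : R) (F : R -> set (set Omega)).
Variables (d : nat) (S : 'I_d -> R -> Omega -> R).
Hypotheses (T_gt0 : 0 < T) (usualF : usual_filtration P T F)
  (semiS : forall i, semimartingale P T F (S i)).
Local Notation process := (R -> Omega -> R).

Let sF := filtration_sigma usualF.
Let monoF := filtration_mono usualF.

Let le0T : 0 <= (0 : R) <= T. Proof. by rewrite lexx ltW. Qed.
Let leTT : 0 <= T <= T. Proof. by rewrite lexx ltW. Qed.

Lemma filtration_measurable (t : R) : 0 <= t <= T -> F t `<=` measurable.
Proof. by move=> /andP[t0 tT]; rewrite -(filtration_final usualF); exact: monoF. Qed.

Lemma adapted_measurable (X : process) (t : R) : 0 <= t <= T ->
  adapted T F X -> measurable_fun setT (X t).
Proof. by move=> ht aX _ B mB; rewrite setTI; exact: (filtration_measurable ht (aX _ ht _ mB)). Qed.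

Lemma filtrationT (t : R) : 0 <= t <= T -> F t setT.
Proof. by move=> /sF[F0 FC _]; rewrite -(setD0 setT); exact: FC. Qed.

Lemma wealth_measurable (x : R) (X : process) : wealth P T F S x X ->
  measurable_fun setT (X T).
Proof. by move=> wX; apply: adapted_measurable => //; exact: wealth_adapted wX. Qed.

(** One null set serves T and all positive rationals below it; right-continuity extends the
    inequality to the other times. *)
Lemma cadlag_ge0 (mu : {measure set Omega -> \bar R}) (X : process) : cadlag T X ->
  (forall t, 0 <= t <= T -> {ae mu, forall w, 0 <= X t w}) ->
  {ae mu, forall w, forall t, 0 <= t <= T -> 0 <= X t w}.
Proof.
move=> cX X0.
have Xq n : {ae mu, forall w, 0 <= X (Num.min (posrat n) T) w}.
  by apply: X0; rewrite le_min ge_min lexx orbT (ltW (posrat_gt0 n)) ltW.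
move: (X0 _ leTT) (ae_foralln Xq); apply: filterS2 => w XT Xqw t /andP[t0].
rewrite le_eqVlt => /predU1P[->//|tT]; rewrite leNgt; apply/negP => Xt.
have [Xr _] := cX w; have := Xr t; rewrite t0 tT => /(_ isT) Xtr.
have : \forall s \near t^'+, X s w < 0 /\ s < T.
  near=> s; split; near: s; last exact: nbhs_right_lt.
  exact: (cvgr_lt _ Xtr).
case=> e /= e0 eP.
have tm : t < Num.min (t + e) T by rewrite lt_min tT ltrDl e0.
have [n /andP[tn]] := posrat_dense t0 tm; rewrite lt_min => /andP[nt nT].
have [|] := eP (posrat n) _ tn.
  by rewrite /ball_/= ltr_distlC nt andbT; lra.
by have := Xqw n; rewrite min_l ?(ltW nT)// => + X0n _; rewrite leNgt X0n.
Unshelve. all: by end_near. Qed.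

Section Separating.
Variable Q0 : probability Omega R.
Hypotheses (eqvQ0 : equivalent_measures Q0 P) (sepQ0 : separating_measure P T F S Q0).

Let PQ0 p : {ae P, forall w, p w} -> {ae Q0, forall w, p w}.
Proof. exact: (dominates_ae eqvQ0.1). Qed.
Let Q0P p : {ae Q0, forall w, p w} -> {ae P, forall w, p w}.
Proof. exact: (dominates_ae eqvQ0.2). Qed.

(* After adding a constant and rescaling, W lies in X(1), so it is a Q0-supermartingale. *)
Lemma wealth_terminal_ge0 (x c : R) (W : process) : wealth P T F S x W ->
  {ae P, forall w, forall t, 0 <= t <= T -> - c <= W t w} ->
  {ae P, forall w, 0 <= W T w} ->
  nonneg_wealth P T F S x W.
Proof.
move=> wW Wc WT; split=> //.
(* Large enough that W + b >= 0 and x + b > 0. *)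
pose b := `|c| + `|x| + 1.
have xb : 0 < x + b.
  by have := ler_norm (- x); rewrite normrN /b; have := normr_ge0 c; lra.
have cb : c <= b by have := ler_norm c; rewrite /b; have := normr_ge0 x; lra.
have b0 : 0 < b by rewrite ltr_wpDl// addr_ge0.
pose V : process := fun t w => (x + b)^-1 * (W t w + b).
have sV : supermartingale T F Q0 V.
  apply: sepQ0; split.
    have := wealthZ T_gt0 sF monoF semiS (x + b)^-1 (wealthD b wW).
    by rewrite mulVf// gt_eqF.
  move: Wc; apply: filterS => w Ww t ht; apply: mulr_ge0; first by rewrite invr_ge0 ltW.
  by have := Ww _ ht; lra.
have [aV iV leV] := sV.
apply: cadlag_ge0; first exact: wealth_cadlag wW.
move=> t ht; apply: Q0P; have /andP[t0 tT] := ht.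
pose a := (x + b)^-1 * b.
have a0 : 0 < a by rewrite mulr_gt0 ?invr_gt0.
pose A := [set w | W t w < 0].
have FA : F t A.
  have := wealth_adapted sF wW ht (measurable_itv `]-oo, 0[).
  by congr (F t _); apply/seteqP; split=> w /=; rewrite in_itv.
have mA := filtration_measurable ht FA.
have VA w : A w -> V t w < a.
  by move=> Aw; rewrite ltr_pM2l ?invr_gt0// gtrDr.
have iA : Q0.-integrable A (EFin \o V t).
  by apply: integrableS (iV _ ht).
have ia : Q0.-integrable A (EFin \o cst a) by exact: finite_measure_integrable_cst.
(* On A, V_t < a while V_T >= a because W_T >= 0; the supermartingale inequality on A then leaves no
   room unless A is null. *)
have aVT : (\int[Q0]_(w in A) a%:E <= \int[Q0]_(w in A) (V t w)%:E)%E.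
  apply: le_trans (leV t T A t0 tT (lexx T) FA); apply: ae_le_integral.
  have := PQ0 WT; apply: filterS => w WTw _; rewrite lee_fin.
  by rewrite ler_pM2l ?invr_gt0// lerDr.
have : (\int[Q0]_(w in A) `|((EFin \o cst a) \- (EFin \o V t)) w| = 0)%E.
  apply/eqP; rewrite eq_le integral_ge0// andbT.
  rewrite (eq_integral ((EFin \o cst a) \- (EFin \o V t))%E); last first.
    move=> w; rewrite inE => /VA Vw; rewrite gee0_abs//= -EFinB lee_fin.
    by rewrite subr_ge0 ltW.
  by rewrite integralB// sube_le0.
move/ae_eq_integral_abs => /(_ mA) H.
have {}H := H (measurable_int _ (integrableB mA ia iA)).
move: H; apply: filterS => w; rewrite /= leNgt => H.
apply/negP => Aw; have := H Aw; rewrite -EFinB => -[]/eqP.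
by rewrite subr_eq0 => /eqP aVw; have := VA _ Aw; rewrite -aVw ltxx.
Qed.

(** Markov's inequality for X / x, whose terminal expectation under Q0 is at most 1. *)
Lemma separating_markov (x : R) (X : process) : 0 < x -> nonneg_wealth P T F S x X ->
  (Q0 [set w | (4 * x < X T w)%R] <= (4^-1)%:E)%E.
Proof.
move=> x0 [wX X0].
pose V : process := fun t w => x^-1 * X t w.
have sV : supermartingale T F Q0 V.
  apply: sepQ0; split.
    have := wealthZ T_gt0 sF monoF semiS x^-1 wX.
    by rewrite mulVf// gt_eqF.
  by move: X0; apply: filterS => w Xw t ht; rewrite mulr_ge0// ?Xw// invr_ge0 ltW.
have [_ iV leV] := sV.
have VT : (\int[Q0]_w (V T w)%:E <= 1)%E.
  apply: (le_trans (leV 0 T setT (lexx 0) (ltW T_gt0) (lexx T) (filtrationT le0T))).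
  rewrite -(probability_setT Q0) -[leRHS]mul1e -integral_cst//.
  apply: ae_le_integral; have := PQ0 (wealth_at0 T_gt0 sF wX).
  by apply: filterS => w Xw _; rewrite /V Xw mulVf// gt_eqF.
set B := [set w | _].
have mB : measurable B.
  by rewrite -[B]setTI; exact: (measurable_fun_ltr (measurable_cst _) (wealth_measurable wX)).
have : (\int[Q0]_w ((4 : R)%:E * (\1_B w)%:E) <= 1)%E.
  apply: (le_trans _ VT); apply: ae_le_integral.
  have := PQ0 X0; apply: filterS => w /(_ _ leTT) Xw _; rewrite -EFinM lee_fin /V indicE.
  have [|_] := boolP (w \in B); last by rewrite mulr0 mulr_ge0// invr_ge0 ltW.
  by rewrite inE /B/= => Bw; rewrite mulr1 ler_pdivlMl// mulrC ltW.
rewrite integralZl//; last exact: integrable_indic.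
rewrite integral_indic// setIT => QB; have {QB} : ((4 : R)%:E * Q0 B <= 1)%E := QB.
have fB : Q0 B \is a fin_num by exact: fin_num_measure.
by rewrite -(fineK fB) -EFinM !lee_fin; lra.
Qed.

End Separating.

Section Replication.
Variables (f : Omega -> R) (X : process) (x0 : R).
Hypotheses (replX : replicates P T F S X f) (X0 : {ae P, forall w, X 0 w = x0}).

Lemma replicating_wealth : exists (Z : process) (c : R),
  [/\ wealth P T F S x0 Z,
      {ae P, forall w, forall t, 0 <= t <= T -> `|Z t w| <= c} &
      {ae P, forall w, Z T w = f w}].
Proof.
have [[y [a [Y [_ [wY Y0] XY]]]] [z [b [Z [_ [_ Z0] XZ]]]] Xf] := replX.
have ya : y + a = x0.
  apply: contrapT => yax0.
  (* Two distinct constants cannot both be the initial value almost surely under a probability. *)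
  have [N [mN N0 NT]] : {ae P, forall w, False}.
    move: X0 (wealth_at0 T_gt0 sF wY); apply: filterS2 => w X0w Y0w.
    by apply: yax0; rewrite -X0w XY// Y0w.
  have : (P setT <= P N)%E.
    by apply: le_measure; rewrite ?inE//; move=> w _; apply: NT => /=.
  by rewrite N0 probability_setT lee_fin ler10.
exists (fun t w => Y t w + a), (`|a| + `|b|); split.
- by rewrite -ya; exact: wealthD.
- move: Y0 Z0; apply: filterS2 => w Yw Zw t ht.
  have := XY _ w ht; have := XZ _ w ht; have := Yw _ ht; have := Zw _ ht.
  have := ler_norm (- b); have := ler_norm (- a); rewrite !normrN.
  have := normr_ge0 a; have := normr_ge0 b.
  by move=> *; rewrite ler_norml; apply/andP; split; lra.
- by move: Xf; apply: filterS => w <-; rewrite XY.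
Qed.

End Replication.

(** * Indifference prices of a replicable claim *)

Section Pricing.
Variables (Q Q0 : probability Omega R).
Hypotheses (eqvQ : equivalent_measures Q P) (eqvQ0 : equivalent_measures Q0 P)
  (sepQ0 : separating_measure P T F S Q0).
Variables (x : R) (x_gt0 : 0 < x) (U : Omega -> R -> \bar R).
Hypothesis utU : utility_field U.

Let PQ p : {ae P, forall w, p w} -> {ae Q, forall w, p w}.
Proof. exact: (dominates_ae eqvQ.1). Qed.

Lemma nonneg_wealth_lin (y e : R) (X : process) : 0 <= e ->
  nonneg_wealth P T F S y X -> nonneg_wealth P T F S (y + e) (fun t w => X t w + e).
Proof.
move=> e0 [wX X0]; split; first exact: wealthD.
by move: X0; apply: filterS => w Xw t ht; rewrite addr_ge0// Xw.
Qed.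

Lemma indifference_price_replicable (f : Omega -> R) (X : process) (x0 : R) :
  replicates P T F S X f -> {ae P, forall w, X 0 w = x0} ->
  indifference_price P T F S f x U Q x0.
Proof.
move=> replX X0 q Z [wZ [z' z'0 Zz'] ZT].
have [Y [c [wY Yc Yf]]] := replicating_wealth replX X0.
pose W : process := fun t w => Z t w + q * Y t w.
have wW : nonneg_wealth P T F S x W.
  apply: (wealth_terminal_ge0 eqvQ0 sepQ0 (c := z' + `|q| * c)).
  - have := wealth_lin T_gt0 sF monoF semiS q wZ wY.
    by rewrite subrK.
  - move: Zz' Yc; apply: filterS2 => w Zw Yw t ht.
    have : `|q * Y t w| <= `|q| * c by rewrite normrM ler_wpM2l// Yw.
    by rewrite ler_norml => /andP[+ _]; have := Zw _ ht; rewrite /W; lra.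
  - by move: ZT Yf; apply: filterS2 => w ZTw YTw; rewrite /W/= YTw.
rewrite (_ : utility_expectation _ _ = utility_expectation Q (fun w => U w (W T w))).
  by apply: ereal_sup_ubound; exists W.
apply: eq_utility_expectation; have := PQ Yf; apply: filterS => w Yw.
by rewrite -Yw.
Qed.

(* Trading away q f with q (x0 - price) = e leaves e units of cash. *)
Lemma indifference_price_cash (f : Omega -> R) (X : process) (x0 price e : R) :
  replicates P T F S X f -> {ae P, forall w, X 0 w = x0} ->
  price != x0 -> indifference_price P T F S f x U Q price -> 0 <= e ->
  forall Z : process, nonneg_wealth P T F S x Z ->
  (utility_expectation Q (fun w => U w (Z T w + e)%R) <=
   maximal_utility P T F S Q U x)%E.
Proof.
move=> replX X0 px0 price_c e0 Z wZ.
have [Y [c [wY Yc Yf]]] := replicating_wealth replX X0.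
have x0p : x0 - price != 0 by rewrite subr_eq0 eq_sym.
pose q := e / (x0 - price).
have qe : x + e + (- q) * x0 = x - q * price by rewrite /q; field.
have [wZe Ze0] := nonneg_wealth_lin e0 wZ.
have := price_c q (fun t w => Z t w + e + (- q) * Y t w).
rewrite -qe => H.
rewrite (_ : utility_expectation _ _ = utility_expectation Q
   (fun w => U w (Z T w + e + - q * Y T w + q * f w)%R)).
  apply: H; split.
  - exact: wealth_lin.
  (* Taking the absolute value of c makes the constant visibly nonnegative. *)
  - exists (`|q| * `|c|) => //; move: Ze0 Yc; apply: filterS2 => w Zw Yw t ht.
    have : `|q * Y t w| <= `|q| * `|c|.
      by rewrite normrM ler_wpM2l// (le_trans (Yw _ ht))// ler_norm.
    by rewrite ler_norml => /andP[_ +]; have := Zw _ ht; lra.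
  - move: Ze0 Yf; apply: filterS2 => w /(_ _ leTT) Zw ->.
    by move: Zw; lra.
apply: eq_utility_expectation; have := PQ Yf; apply: filterS => w ->.
by congr (U w _); ring.
Qed.

(** (X + 1) / (y + 1) lies in X(1), so its product with Y has terminal expectation at most 1. The
    truncation at 0 changes X_T only on a null set and fits [utility_bound], which wants
    nonnegativity everywhere. *)
Lemma deflator_bound (y : R) (Y : process) (X : process) : 0 <= y ->
  deflators P T F S Q 1 Y -> nonneg_wealth P T F S y X ->
  (\int[Q]_w `|(Num.max (X T w) 0 + 1) * Y T w|%:E <= (y + 1)%:E)%E.
Proof.
move=> y0 [Y0 Y01 sY] wX.
have y1 : 0 < y + 1 by rewrite ltr_wpDl.
have [wX1 X10] := nonneg_wealth_lin ler01 wX.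
pose V : process := fun t w => (y + 1)^-1 * (X t w + 1).
have wV : nonneg_wealth P T F S 1 V.
  split.
    have := wealthZ T_gt0 sF monoF semiS (y + 1)^-1 wX1.
    by rewrite mulVf// gt_eqF.
  by move: X10; apply: filterS => w Xw t ht; rewrite mulr_ge0// ?Xw// invr_ge0 ltW.
have [_ iVY leVY] := sY _ wV.
have VY1 : (\int[Q]_w (V T w * Y T w)%:E <= 1)%E.
  apply: (le_trans (leVY 0 T setT (lexx 0) (ltW T_gt0) (lexx T) (filtrationT le0T))).
  rewrite -(probability_setT Q) -[leRHS]mul1e -integral_cst//.
  apply: ae_le_integral; have := PQ Y01; have := PQ (wealth_at0 T_gt0 sF wV.1).
  by apply: filterS2 => w Vw Yw _; rewrite Vw mul1r lee_fin.
apply: (@le_trans _ _ (\int[Q]_w ((y + 1)%:E * (V T w * Y T w)%:E))%E).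
  apply: ae_le_integral; have := PQ Y0; have := PQ wX.2.
  apply: filterS2 => w /(_ _ leTT) Xw /(_ _ leTT) Yw _.
  rewrite -EFinM lee_fin max_l// ger0_norm; last by rewrite mulr_ge0// addr_ge0.
  by rewrite /V -mulrA mulVKf// gt_eqF.
rewrite integralZl//; last exact: iVY.
by rewrite -[leRHS]mule1 lee_pmul2l ?lte_fin// fin_numE.
Qed.

(** One deflator with finite conjugate expectation serves all wealth processes at once, so c depends
    neither on y nor on X. *)
Lemma utility_integral_bound : (minimal_conjugate P T F S Q U 1 < +oo)%E ->
  exists2 c : \bar R, (c < +oo)%E & forall (y : R) (X : process), 0 <= y ->
    nonneg_wealth P T F S y X ->
    (\int[Q]_w (fun w => U w (Num.max (X T w) 0)%R)^\+ w <= c + (y + 1)%:E)%E.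
Proof.
move=> /ereal_inf_lt[_ [Y dY <-] Yoo].
(* If no nonnegative wealth process exists, the bound is vacuous. Otherwise 0 X + 1 shows that the
   constant 1 is in X(1), and the measurability of Y_T comes from the adaptedness of 1 Y. *)
have [[X wX]|noX] := pselect (exists X, exists y, 0 <= y /\ nonneg_wealth P T F S y X); last first.
  by exists 0%E => // y X y0 wX; case: noX; exists X, y.
have [y [y0 [wX' _]]] := wX.
have w1 : nonneg_wealth P T F S 1 (fun t w => 0 * X t w + 1).
  split; last by apply: aeW => w t _; rewrite mul0r add0r.
  have := wealthD 1 (wealthZ T_gt0 sF monoF semiS 0 wX').
  by rewrite mul0r add0r.
have mY : measurable_fun setT (Y T).
  have [_ _ /(_ _ w1) [aY _ _]] := dY.
  have := adapted_measurable leTT aY; congr measurable_fun.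
  by apply/funext => w; rewrite mul0r add0r mul1r.
have [c coo cP] := utility_bound utU mY Yoo.
exists c => // z Z z0 wZ.
apply: (le_trans (cP (fun w => Num.max (Z T w) 0) _ _)).
- by move=> w; rewrite le_max lexx orbT.
- by apply: measurable_maxr => //; exact: wealth_measurable wZ.1.
- by apply: leeD2l; exact: deflator_bound.
Qed.

Lemma maximal_utility_lty : (minimal_conjugate P T F S Q U 1 < +oo)%E ->
  (maximal_utility P T F S Q U x < +oo)%E.
Proof.
move=> /utility_integral_bound[c coo cP].
apply: (@le_lt_trans _ _ (c + (x + 1)%:E)%E); last exact: lte_add_pinfty (ltry _).
apply: ge_ereal_sup => _ [X wX <-]; apply: le_trans (cP _ _ (ltW x_gt0) wX).
rewrite (_ : utility_expectation _ _ =
  utility_expectation Q (fun w => U w (Num.max (X T w) 0)%R)); last first.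
  apply: eq_utility_expectation; have := PQ wX.2; apply: filterS => w /(_ _ leTT) Xw.
  by rewrite max_l.
rewrite /utility_expectation; case: ifPn => _; first exact: leNye.
by rewrite integralE -[leRHS]sube0; apply: leeB => //; exact: integral_ge0.
Qed.

(** With g the uniform gain from the cash e, any X whose expected utility exceeds u(x) - g will do;
    it exists because u(x) is finite. *)
Lemma maximal_utility_cash (e : R) : 0 < e ->
  (-oo < maximal_utility P T F S Q U x)%E ->
  (minimal_conjugate P T F S Q U 1 < +oo)%E ->
  exists2 X : process, nonneg_wealth P T F S x X &
    (maximal_utility P T F S Q U x <
     utility_expectation Q (fun w => U w (X T w + e)%R))%E.
Proof.
move=> e0 unoo Vfin; have uoo := maximal_utility_lty Vfin.
have ufin : maximal_utility P T F S Q U x \is a fin_num.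
  by rewrite fin_real// unoo uoo.
have k0 : 0 < 4 * x by rewrite mulr_gt0.
have Q0Q : Q0 `<< Q by exact: null_dominates_trans eqvQ0.1 eqvQ.2.
have [g g0 gP] := utility_gap utU Q0Q k0 e0.
have [_ [X wX <-] Xu] := ub_ereal_sup_adherent g0 ufin.
exists X => //.
pose Xp w := Num.max (X T w) 0.
have Xp0 w : 0 <= Xp w by rewrite le_max lexx orbT.
have mXp : measurable_fun setT Xp.
  by apply: measurable_maxr => //; exact: wealth_measurable wX.1.
have XXp : {ae Q, forall w, Xp w = X T w}.
  by have := PQ wX.2; apply: filterS => w /(_ _ leTT) Xw; rewrite /Xp max_l.
have [c coo cP] := utility_integral_bound Vfin.
have UXe : utility_expectation Q (fun w => U w (X T w + e)%R) =
    utility_expectation Q (fun w => U w (Xp w + e)%R).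
  by apply: eq_utility_expectation; move: XXp; apply: filterS => w ->.
have UX : utility_expectation Q (fun w => U w (X T w)) =
    utility_expectation Q (fun w => U w (Xp w)).
  by apply: eq_utility_expectation; move: XXp; apply: filterS => w ->.
move: Xu; rewrite UXe UX {UX UXe} /utility_expectation.
(* Near-optimality rules out the value -oo, so the negative part is integrable. *)
case: ifPn => [_|Un]; first by rewrite ltNge leNye.
have {}Un : (\int[Q]_w (fun w => U w (Xp w))^\- w < +oo)%E by rewrite ltey.
have Une : (\int[Q]_w (fun w => U w (Xp w + e)%R)^\- w < +oo)%E.
  apply: le_lt_trans Un; apply: ae_ge0_le_lower_integral => //.
  apply: aeW => w; rewrite !funenegE; apply: le_max2 => //; rewrite leeN2.
  by apply: utility_le; rewrite // lerDl ltW.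
rewrite ifN; last by rewrite -ltey.
have iU : Q.-integrable setT (fun w => U w (Xp w)).
  apply: integrable_funeposneg => //; first exact: measurable_utility.
  apply: le_lt_trans (cP _ _ (ltW x_gt0) wX) _; exact: lte_add_pinfty (ltry _).
have iUe : Q.-integrable setT (fun w => U w (Xp w + e)%R).
  apply: integrable_funeposneg => //.
    apply: measurable_utility => //; first by move=> w; rewrite addr_ge0// ltW.
    exact: measurable_funD.
  (* X + e lies in X(x + e), so the same bound controls the positive part of its utility. *)
  have xe0 : 0 <= x + e by rewrite addr_ge0 ?ltW.
  apply: le_lt_trans (lte_add_pinfty coo (ltry (x + e + 1))).
  apply: le_trans (cP _ _ xe0 (nonneg_wealth_lin (ltW e0) wX)).
  apply: ae_ge0_le_lower_integral => //.
  move: XXp; apply: filterS => w Xw; rewrite !funeposE.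
  rewrite (_ : Num.max (X T w + e) 0 = Xp w + e)//.
  by rewrite -Xw max_l// addr_ge0// ltW.
move=> Xu; have := gP _ Xp0 mXp _ iU iUe.
(* Truncation at 0 does not affect the event, as 4 x > 0. *)
have -> : [set w | 4 * x < Xp w] = [set w | 4 * x < X T w].
  apply/seteqP; split=> w /=; rewrite /Xp lt_max; last by move=> ->.
  by case/orP => // ?; exfalso; lra.
move=> /(_ (separating_markov eqvQ0 sepQ0 x_gt0 wX)); apply: lt_le_trans.
by move: Xu; rewrite lteBlDr.
Qed.

End Pricing.

End Market.

Unset Implicit Arguments.
Set Strict Implicit.
Set Printing Implicit Defensive.

Theorem lemma4p4 (disp : measure_display) (Omega : measurableType disp)
    (R : realType) (P : probability Omega R) (T : R)
    (F : R -> set (set Omega)) (d : nat) (S : 'I_d -> R -> Omega -> R)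
    (T_gt0 : 0 < T)
    (usualF : usual_filtration P T F)
    (semiS : forall i, semimartingale P T F (S i))
    (sepS : exists Q0 : probability Omega R,
      equivalent_measures Q0 P /\ separating_measure P T F S Q0)
    (Q : probability Omega R) (eqvQ : equivalent_measures Q P)
    (x : R) (x_gt0 : 0 < x)
    (U : Omega -> R -> \bar R) (FVU : finite_value_field P T F S Q U)
    (f : Omega -> R) (bndf : bounded_claim P f)
    (X : R -> Omega -> R) (replX : replicates P T F S X f)
    (x0 : R) (X0 : {ae P, forall w, X 0 w = x0}) :
  unique (indifference_price P T F S f x U Q) x0.
Proof.
have [Q0 [eqvQ0 sepQ0]] := sepS; have [utU ux uV] := FVU; split.
  exact: (indifference_price_replicable T_gt0 usualF semiS eqvQ eqvQ0 sepQ0 U replX X0).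
move=> p pp; apply/eqP; rewrite eq_sym; apply/negPn/negP => px0.
(* Any positive amount of cash would serve; it is taken to be 1. *)
have [Z wZ uZ] := maximal_utility_cash T_gt0 usualF semiS eqvQ eqvQ0 sepQ0
  x_gt0 utU ltr01 (ux _ x_gt0) (uV _ ltr01).
have := indifference_price_cash T_gt0 usualF semiS eqvQ replX X0 px0 pp ler01 wZ.
by rewrite leNgt uZ.
Qed.
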